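(* $L^\infty_r(\mathbb{R}^n)$ is a maximal abelian subalgebra of $B(L^2_r(\mathbb{R}^n))$.
   Context: Fix $n\ge 1$ and $m>0$, and let $E(\vec p)=\sqrt{|\vec p|^2+m^2}$ for $\vec p\in\mathbb{R}^n$. Let $L^2_r(\mathbb{R}^n)=L^2(\mathbb{R}^n,d\vec p/E(\vec p))$. For $\vec a\in\mathbb{R}^n$ let $T_{\vec a}$ be the bounded translation operator on $L^2_r(\mathbb{R}^n)$, $T_{\vec a}\phi(\vec p)=\phi(\vec p-\vec a)$. $L^\infty_r(\mathbb{R}^n)\subset B(L^2_r(\mathbb{R}^n))$ is the commutant of $\{T_{\vec a}:\vec a\in\mathbb{R}^n\}$. Subalgebras here are not assumed to be closed under adjoints. *)

(* Defs.v *)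
(* The reals are an arbitrary R : realType, the complex numbers are R[i]. *)
From HB Require Import structures.
From mathcomp Require Import all_boot all_order all_algebra.
From mathcomp Require Import all_classical all_reals all_analysis.
From mathcomp Require Import measurable_realfun complex.
From mathcomp Require Import lra.
From mathcomp Require Import ring_quotient generic_quotient.
Set Implicit Arguments. Unset Strict Implicit. Unset Printing Implicit Defensive.
Import Order.TTheory GRing.Theory Num.Theory.
Import numFieldNormedType.Exports.
Local Open Scope classical_set_scope.
Local Open Scope ring_scope.

Lemma sigma_finite_product d1 d2 (T1 : measurableType d1) (T2 : measurableType d2)
    (R : realType) (m1 : {sigma_finite_measure set T1 -> \bar R})
    (m2 : {sigma_finite_measure set T2 -> \bar R}) :
  sigma_finite [set: T1 * T2] (m1 \x m2)%E.
Proof.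
have /sigma_finiteP[F [TF ndF Foo]] := sigma_finiteT m1.
have /sigma_finiteP[G [TG ndG Goo]] := sigma_finiteT m2.
exists (fun n => F n `*` G n).
  rewrite -setXTT TF TG predeqE => -[x y]; split.
    move=> [/= [n _ Fnx] [k _ Gky]]; exists (maxn n k) => //; split.
    - by move: x Fnx; exact/subsetPset/ndF/leq_maxl.
    - by move: y Gky; exact/subsetPset/ndG/leq_maxr.
  by move=> [n _ []/= ? ?]; split; exists n.
move=> k; have [? ?] := Foo k; have [? ?] := Goo k.
split; first exact: measurableX.
by rewrite product_measure1E// lte_mul_pinfty// ge0_fin_numE.
Qed.

Section euclidean_space.
Context (R : realType).

(* R^n with its Borel sigma-algebra (the one generated by the coordinates);
   measurableTypeR R is R as the carrier of lebesgue_measure. *)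
Definition euclid (n : nat) : Type := n.-tuple (measurableTypeR R).
HB.instance Definition _ n := Measurable.on (euclid n).

Definition coord n (p : euclid n) (i : 'I_n) : R := tnth p i.

Definition vsub n (p a : euclid n) : euclid n :=
  [tuple (coord p i - coord a i : measurableTypeR R) | i < n].

Definition vcons n (x : measurableTypeR R * euclid n) : euclid n.+1 :=
  [tuple of x.1 :: x.2].

(* n-dimensional Lebesgue measure, as an iterated product of lebesgue_measure
   transported along R * R^k ~ R^(k+1); see lebesgue_n_box. *)
Fixpoint lebesgue_n (n : nat) : set (euclid n) -> \bar R :=
  match n with
  | 0 => \d_([tuple] : euclid 0)
  | k.+1 => pushforward (lebesgue_measure \x @lebesgue_n k)%E (@vcons k)
  end.

Lemma measurable_vcons n : measurable_fun setT (@vcons n).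
Proof. exact: measurable_cons. Qed.

Lemma lebesgue_n_ex n : exists m : {sigma_finite_measure set (euclid n) -> \bar R},
  (m : set (euclid n) -> \bar R) = @lebesgue_n n.
Proof.
elim: n => [|n [m mE]] /=.
  by exists (\d_([tuple] : euclid 0)).
rewrite -mE.
pose nu : {measure set (euclid n.+1) -> \bar R} :=
  pushforward (lebesgue_measure \x m)%E (@vcons n).
pose g (p : euclid n.+1) : measurableTypeR R * euclid n :=
  (thead p, [tuple of behead p]).
have mg : measurable_fun setT g.
  apply/measurable_fun_pair => /=.
    exact: measurable_tnth.
  exact: measurable_behead.
have sf : sigma_finite setT (pushforward (lebesgue_measure \x m)%E (@vcons n)).
  have [F TF Foo] := sigma_finite_product (@lebesgue_measure R) m.
  exists (fun k => g @^-1` F k); first by rewrite -preimage_bigcup -TF preimage_setT.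
  move=> k; have [mF Fk] := Foo k; split.
    by rewrite -[X in measurable X]setTI; exact: mg.
  rewrite /pushforward -comp_preimage (_ : g \o _ = idfun)//.
  by apply/funext => -[x p] /=; rewrite /g /vcons /= theadE; congr pair; exact/val_inj.
pose B := Measure_isSigmaFinite.Build _ _ _ (nu (@measurable_vcons n)) sf.
pose nu' : {sigma_finite_measure set (euclid n.+1) -> \bar R} := HB.pack (nu (@measurable_vcons n) : _ -> _) (nu (@measurable_vcons n)) B.
by exists nu'.
Qed.

Let lebesgue_n0 n : @lebesgue_n n set0 = 0.
Proof. by have [m <-] := lebesgue_n_ex n; rewrite measure0. Qed.

Let lebesgue_n_ge0 n A : (0 <= @lebesgue_n n A)%E.
Proof. by have [m <-] := lebesgue_n_ex n; rewrite measure_ge0. Qed.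

Let lebesgue_n_sigma_additive n : semi_sigma_additive (@lebesgue_n n).
Proof.
by have [m <-] := lebesgue_n_ex n; exact: measure_semi_sigma_additive.
Qed.

HB.instance Definition _ n := isMeasure.Build _ _ _ (@lebesgue_n n)
  (lebesgue_n0 n) (@lebesgue_n_ge0 n) (@lebesgue_n_sigma_additive n).

Let lebesgue_n_sigma_finite n : sigma_finite setT (@lebesgue_n n).
Proof. by have [m <-] := lebesgue_n_ex n; exact: sigma_finiteT. Qed.

HB.instance Definition _ n := Measure_isSigmaFinite.Build _ _ _
  (@lebesgue_n n) (@lebesgue_n_sigma_finite n).

Lemma measurable_coord n (i : 'I_n) :
  measurable_fun setT (fun p : euclid n => coord p i).
Proof. exact: measurable_tnth. Qed.

Lemma coord_vcons0 n x (p : euclid n) : coord (vcons (x, p)) ord0 = x.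
Proof. by []. Qed.

Lemma coord_vconsS n x (p : euclid n) i :
  coord (vcons (x, p)) (lift ord0 i) = coord p i.
Proof. by rewrite /coord /vcons tnthS. Qed.

Lemma lebesgue_n_box n (A : 'I_n -> set (measurableTypeR R)) :
  (forall i, measurable (A i)) ->
  lebesgue_n [set p : euclid n | forall i, A i (coord p i)] =
  (\prod_(i < n) lebesgue_measure (A i))%E.
Proof.
elim: n A => [|n IHn] A mA /=.
  by rewrite big_ord0 diracE mem_set//=; case.
rewrite big_ord_recl /= -IHn; last by move=> i; exact: mA.
rewrite /pushforward (_ : _ @^-1` _ = A ord0 `*`
   [set p : euclid n | forall i, A (lift ord0 i) (coord p i)]); last first.
  apply/seteqP; split => [[x p] /= H|[x p] /= [Ax Ap] i].
    split; first by rewrite -[x](@coord_vcons0 n x p); exact: H.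
    by move=> i; rewrite -(coord_vconsS x); exact: H.
  by case: (unliftP ord0 i) => [j ->|->]; rewrite ?coord_vconsS ?coord_vcons0.
have mB : measurable [set p : euclid n | forall i, A (lift ord0 i) (coord p i)].
  rewrite (_ : mkset _ = \bigcap_(i : 'I_n)
      (fun p : euclid n => coord p i) @^-1` A (lift ord0 i)); last first.
    by apply/seteqP; split => p /= H i; [move=> _|]; exact: H.
  apply: fin_bigcap_measurable => // i _; rewrite -[X in measurable X]setTI.
  by apply: measurable_coord => //; exact: mA.
by rewrite product_measure1E.
Qed.

Lemma measurable_vsub n (a : euclid n) : measurable_fun setT (fun p => vsub p a).
Proof.
apply/measurable_fun_tnthP => i.
rewrite (_ : _ \o _ = fun p => coord p i - coord a i); last first.
  by apply/funext => p /=; rewrite tnth_mktuple.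
by apply: measurable_funB => //; exact: measurable_coord.
Qed.

Lemma lebesgue_measure_sub (a : R) (A : set (measurableTypeR R)) : measurable A ->
  pushforward lebesgue_measure
    (fun x : measurableTypeR R => x - a : measurableTypeR R) A =
  lebesgue_measure A.
Proof.
have ma : measurable_fun setT (fun x : measurableTypeR R => x - a : measurableTypeR R).
  exact: measurable_funB.
pose nu : {measure set (measurableTypeR R) -> \bar R} :=
  pushforward lebesgue_measure
    (fun x : measurableTypeR R => x - a : measurableTypeR R).
move=> mA; apply/esym; apply: (lebesgue_measure_unique (mu := nu ma)) => //= _ [[x y]] _ <-.
rewrite /nu /= /pushforward /=.
rewrite (_ : _ @^-1` _ = `](x + a)%R, (y + a)%R]%classic); last first.
  by apply/seteqP; split => z /=; rewrite !in_itv/= ltrBrDr lerBlDr.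
rewrite !lebesgue_measure_itv /= !lte_fin ltrD2r.
by case: ifPn => // _; rewrite -!EFinD; congr (_%:E); rewrite opprD addrACA subrr addr0.
Qed.

Lemma lebesgue_n_vsub n (a : euclid n) (A : set (euclid n)) : measurable A ->
  lebesgue_n ((fun p => vsub p a) @^-1` A) = lebesgue_n A.
Proof.
elim: n a A => [|n IHn] a A mA /=.
  congr (\d_ _ _); apply/seteqP.
  by split => p; rewrite /preimage /= (tuple0 p) (tuple0 (vsub _ _)).
pose a0 : R := coord a ord0.
pose a' : euclid n := [tuple of behead a].
pose h (x : measurableTypeR R * euclid n) : measurableTypeR R * euclid n :=
  ((x.1 : R) - a0, vsub x.2 a').
have mh : measurable_fun setT h.
  apply: measurable_fun_pair.
    by apply: measurable_funB => //; exact: measurable_fst.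
  exact: (measurableT_comp (measurable_vsub a') measurable_snd).
have mvA : measurable (@vcons n @^-1` A).
  by rewrite -[X in measurable X]setTI; exact: measurable_vcons.
pose nu : {measure set _ -> \bar R} := pushforward (lebesgue_measure \x @lebesgue_n n)%E h.
have Eh : @vcons n @^-1` ((fun p => vsub p a) @^-1` A) = h @^-1` (@vcons n @^-1` A).
  have vh y : vsub (vcons y) a = vcons (h y).
    apply: eq_from_tnth => i; rewrite tnth_mktuple.
    case: (unliftP ord0 i) => [j ->|->]; last by [].
    case: y => x p; rewrite coord_vconsS [RHS](coord_vconsS _ _ j) /coord.
    rewrite tnth_mktuple /coord; congr (_ - _ : R).
    by rewrite [in LHS](tuple_eta a) tnthS.
  by apply/seteqP; split => y /=; rewrite vh.
rewrite /pushforward Eh [RHS](product_measure_unique (m' := nu mh))//=.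
move=> B C mB mC; rewrite /nu /pushforward /=.
rewrite (_ : h @^-1` _ = ((fun x : measurableTypeR R => (x : R) - a0 : measurableTypeR R) @^-1` B)
    `*` ((fun p => vsub p a') @^-1` C))//.
have mB' : measurable ((fun x : measurableTypeR R => (x : R) - a0 : measurableTypeR R) @^-1` B).
  by rewrite -[X in measurable X]setTI; apply: measurable_funB.
have mC' : measurable ((fun p => vsub p a') @^-1` C).
  by rewrite -[X in measurable X]setTI; exact: measurable_vsub.
rewrite product_measure1E//.
transitivity (pushforward lebesgue_measure
  (fun x : measurableTypeR R => (x - a0)%R : measurableTypeR R) B * lebesgue_n C)%E.
  by rewrite -(IHn a' C mC).
by rewrite lebesgue_measure_sub.
Qed.
End euclidean_space.

Section complex_L2.
Context d (T : measurableType d) (R : realType) (mu : {measure set T -> \bar R}).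

Local Notation normc := (@ComplexField.Normc.normc R).

Definition enorm2 (f : T -> R[i]) : \bar R :=
  'N[mu]_2%:E[EFin \o (normc \o f)]%E.

(* R[i] has no measurable structure in the library: a complex function is
   measurable when its real and imaginary parts are. *)
Definition sqintegrable : {pred T -> R[i]^o} := [pred f |
  `[< [/\ measurable_fun setT (fun x => complex.Re (f x)),
          measurable_fun setT (fun x => complex.Im (f x)) &
          (enorm2 f < +oo)%E] >]].

Lemma measurable_normc (f : T -> R[i]) :
  measurable_fun setT (fun x => complex.Re (f x)) ->
  measurable_fun setT (fun x => complex.Im (f x)) ->
  measurable_fun setT (fun x => normc (f x)).
Proof.
move=> mRe mIm.
rewrite (_ : (fun x => _) = Num.sqrt \o
    (fun x => complex.Re (f x) ^+ 2 + complex.Im (f x) ^+ 2)); last first.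
  by apply/funext => x /=; case: (f x).
apply: measurableT_comp.
  by apply: continuous_measurable_fun; exact: sqrt_continuous.
by apply: measurable_funD; apply: measurable_funX.
Qed.

Lemma le_enorm2 (f : T -> R[i]) (g : T -> R) :
  measurable_fun setT (fun x => complex.Re (f x)) ->
  measurable_fun setT (fun x => complex.Im (f x)) ->
  measurable_fun setT g -> (forall x, normc (f x) <= g x) ->
  (enorm2 f <= 'N[mu]_2%:E [EFin \o g])%E.
Proof.
move=> mR mI mg fg; rewrite /enorm2 unlock gt0_ler_poweR//=.
- by rewrite in_itv/= leey andbT; apply: integral_ge0 => x _; rewrite lee_fin powR_ge0.
- by rewrite in_itv/= leey andbT; apply: integral_ge0 => x _; rewrite lee_fin powR_ge0.
apply: ge0_le_integral => //=.
- apply/measurable_EFinP; apply: (@measurableT_comp _ _ _ _ _ _ (@powR R ^~ 2)) => //.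
  by apply: measurableT_comp => //; exact: measurable_normc.
- apply/measurable_EFinP; apply: (@measurableT_comp _ _ _ _ _ _ (@powR R ^~ 2)) => //.
  exact: measurableT_comp.
move=> x _; have nf0 : 0 <= normc (f x) by case: (f x) => a b; exact: sqrtr_ge0.
rewrite lee_fin ge0_ler_powR ?nnegrE//.
by rewrite !ger0_norm//; apply: le_trans (fg x).
Qed.

Let sqintegrable_submod_closed : submod_closed sqintegrable.
Proof.
split=> [|c f g].
  apply/asboolP; split=> //=.
  rewrite /enorm2 (_ : _ \o _ = cst 0%E) ?Lnorm0 ?ltry//.
  by apply/funext => x /=; rewrite expr0n/= addr0 sqrtr0.
move=> /asboolP[mRf mIf ff] /asboolP[mRg mIg fg]; apply/asboolP.
have E x : (c *: f + g) x = c * f x + g x by [].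
have mR : measurable_fun setT (fun x => complex.Re ((c *: f + g) x)).
  rewrite (_ : (fun _ => _) = fun x => (complex.Re c * complex.Re (f x) -
    complex.Im c * complex.Im (f x)) + complex.Re (g x)).
    apply: measurable_funD => //; apply: measurable_funB;
    by apply: measurable_funM.
  apply/funext => x; rewrite E.
  by case: (f x) (g x) => [a b] [u v]; case: (c).
have mI : measurable_fun setT (fun x => complex.Im ((c *: f + g) x)).
  rewrite (_ : (fun _ => _) = fun x => (complex.Re c * complex.Im (f x) +
    complex.Im c * complex.Re (f x)) + complex.Im (g x)).
    apply: measurable_funD => //; apply: measurable_funD;
    by apply: measurable_funM.
  apply/funext => x; rewrite E.
  by case: (f x) (g x) => [a b] [u v]; case: (c).
split => //.
have mf := measurable_normc mRf mIf.
have mg := measurable_normc mRg mIg.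
have fL : normc \o f \in Lfun mu 2%:E.
  by rewrite inE; apply/andP; split; rewrite !inE.
have /(_ (normc c)) := Lfun_scale _ _ fL; rewrite ler1n => /(_ isT).
rewrite inE => /andP[/[!inE] /= mcf cf].
apply: (@le_lt_trans _ _ ('N[mu]_2%:E[EFin \o
    ((normc c \o* (normc \o f)) \+ (normc \o g))%R])%E).
  apply: le_enorm2 => //.
    by apply: measurable_funD.
  move=> x; rewrite E /= mulrC; apply: le_trans (le_normcD _ _) _.
  by rewrite ComplexField.Normc.normcM.
apply: (le_lt_trans (minkowski_EFin _ _ _ _)) => //.
  by rewrite ler1n.
by rewrite lte_add_pinfty.
Qed.
HB.instance Definition _ := GRing.isSubmodClosed.Build _ _ sqintegrable
  sqintegrable_submod_closed.

Record L2fun := MkL2fun {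
  L2val :> T -> R[i]^o ;
  L2valP : L2val \in sqintegrable }.
HB.instance Definition _ := [isSub for L2val].
HB.instance Definition _ := [Choice of L2fun by <:].
HB.instance Definition _ := [SubChoice_isSubLmodule of L2fun by <:].

Definition ae_null : {pred L2fun} := [pred f : L2fun |
  `[< (f : T -> R[i]^o) = 0 %[ae mu] >]].

Let ae_null_zmod_closed : zmod_closed ae_null.
Proof.
split; first by apply/asboolP; exact: aeW.
move=> f g /asboolP f0 /asboolP g0; apply/asboolP.
by apply: filterS2 f0 g0 => x fx gx xT; rewrite -[LHS]/(f x - g x) fx// gx// subrr.
Qed.
HB.instance Definition _ := GRing.isZmodClosed.Build _ ae_null
  ae_null_zmod_closed.

(* L^2(mu; C): square-integrable functions modulo equality mu-a.e. *)
Definition L2 : Type := Quotient.quot ae_null.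
HB.instance Definition _ := GRing.Zmodule.on L2.
HB.instance Definition _ := EqQuotient.on L2.

Definition L2class : L2fun -> L2 := \pi_L2%qT.

Lemma L2class_eqP (f g : L2fun) :
  L2class f = L2class g <-> (f : T -> R[i]^o) = g %[ae mu].
Proof.
have -> : L2class f = L2class g <-> f - g \in ae_null.
  rewrite (Quotient.idealrBE ae_null f g); split; last by move/eqP.
  by move=> fg; apply/eqP.
split=> [/asboolP fg|fg]; [|apply/asboolP]; apply: filterS fg => x fg xT.
  by apply/eqP; rewrite -subr_eq0; apply/eqP; exact: fg.
by rewrite -[LHS]/(f x - g x) fg// subrr.
Qed.

Lemma L2class_repr (u : L2) : L2class (repr u) = u.
Proof. exact: reprK. Qed.

Lemma repr_L2class (f : L2fun) :
  (repr (L2class f) : T -> R[i]^o) = f %[ae mu].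
Proof. by apply/L2class_eqP; rewrite L2class_repr. Qed.

Lemma L2classD (f g : L2fun) : L2class (f + g) = L2class f + L2class g.
Proof. by rewrite /L2class !piE. Qed.

Definition L2scale (c : R[i]) (u : L2) : L2 := L2class (c *: repr u).

Lemma L2classZ (c : R[i]) (f : L2fun) :
  L2class (c *: f) = L2scale c (L2class f).
Proof.
apply/L2class_eqP; apply: filterS (repr_L2class f) => x fx xT.
by rewrite -[LHS]/(c * f x) -[RHS]/(c * repr (L2class f) x) fx.
Qed.

Let L2scaleA a b v : L2scale a (L2scale b v) = L2scale (a * b) v.
Proof. by rewrite -[v]L2class_repr -!L2classZ scalerA. Qed.

Let L2scale1 : left_id 1 L2scale.
Proof. by move=> v; rewrite -[v]L2class_repr -!L2classZ scale1r. Qed.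

Let L2scaleDr : right_distributive L2scale +%R.
Proof.
move=> a u v; rewrite -[u]L2class_repr -[v]L2class_repr.
by rewrite -L2classD -!L2classZ scalerDr L2classD.
Qed.

Let L2scaleDl v : {morph L2scale^~ v : a b / a + b}.
Proof.
by move=> a b; rewrite -[v]L2class_repr -!L2classZ scalerDl L2classD.
Qed.
HB.instance Definition _ := GRing.Zmodule_isLmodule.Build R[i] L2
  L2scaleA L2scale1 L2scaleDr L2scaleDl.

Definition L2norm (u : L2) : R := fine (enorm2 (repr u)).


Lemma eq_enorm2 (f g : T -> R[i]) :
  measurable_fun setT (fun x => normc (f x)) ->
  measurable_fun setT (fun x => normc (g x)) ->
  f = g %[ae mu] -> enorm2 f = enorm2 g.
Proof.
move=> mf mg fg; rewrite /enorm2 unlock; congr (_ `^ _)%E.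
apply: ae_eq_integral => //=.
- apply/measurable_EFinP; apply: (@measurableT_comp _ _ _ _ _ _ (@powR R ^~ 2)) => //.
  exact: measurableT_comp.
- apply/measurable_EFinP; apply: (@measurableT_comp _ _ _ _ _ _ (@powR R ^~ 2)) => //.
  exact: measurableT_comp.
by apply: filterS fg => x fg xT /=; rewrite fg.
Qed.

Lemma measurable_normc_L2fun (f : L2fun) :
  measurable_fun setT (fun x => normc (f x)).
Proof. by case: f => f /= /asboolP[? ? _]; exact: measurable_normc. Qed.

Lemma enorm2_fin_num (f : L2fun) : enorm2 f \is a fin_num.
Proof.
by rewrite ge0_fin_numE ?Lnorm_ge0//; case: f => f /= /asboolP[].
Qed.

Lemma L2norm_class (f : L2fun) : L2norm (L2class f) = fine (enorm2 f).
Proof.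
congr fine; apply: eq_enorm2 => //; last exact: repr_L2class.
- exact: measurable_normc_L2fun.
- exact: measurable_normc_L2fun.
Qed.

Lemma L2class_scale (c : R[i]) (f : L2fun) : L2class (c *: f) = c *: L2class f.
Proof. exact: L2classZ. Qed.

Section pullback.
Variables (h : T -> T) (C : R).
Hypotheses (mh : measurable_fun setT h)
  (hC : forall A, measurable A -> (mu (h @^-1` A) <= C%:E * mu A)%E).

Lemma ae_eq_pullback (f g : T -> R[i]) :
  f = g %[ae mu] -> f \o h = g \o h %[ae mu].
Proof.
case=> N [mN N0 fgN]; exists (h @^-1` N); split.
- by rewrite -[X in measurable X]setTI; exact: mh.
- by apply/eqP; rewrite -measure_le0 (le_trans (hC mN))// N0 mule0.
by move=> x /= Hx; apply: fgN.
Qed.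

Hypothesis C0 : 0 <= C.

Lemma enorm2_pullback (f : T -> R[i]) :
  measurable_fun setT (fun x => normc (f x)) ->
  (enorm2 (f \o h) <= (C `^ 2^-1)%:E * enorm2 f)%E.
Proof.
move=> mf; rewrite /enorm2 unlock -poweR_EFin -poweRM//; last first.
  by apply: integral_ge0 => x _; exact: poweR_ge0.
pose g x := (`|normc (f x)| `^ 2)%:E.
have mg : measurable_fun setT g.
  apply/measurable_EFinP; apply: (@measurableT_comp _ _ _ _ _ _ (@powR R ^~ 2)) => //.
  exact: measurableT_comp.
have g0 x : (0 <= g x)%E by rewrite lee_fin powR_ge0.
pose nu : {measure set T -> \bar R} := pushforward mu h.
have main : (\int[mu]_x (g (h x)) <= C%:E * \int[mu]_x g x)%E.
  rewrite -[X in (X <= _)%E]/(\int[mu]_(x in h @^-1` setT) (g \o h) x)%E.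
  rewrite -ge0_integral_pushforward//.
  rewrite -(ge0_integral_mscale _ _ (NngNum C0))//.
  exact: (ge0_le_measure_integral (m1 := nu mh)).
rewrite gt0_ler_poweR//=.
- by rewrite in_itv/= leey andbT; apply: integral_ge0 => x _; rewrite lee_fin powR_ge0.
- rewrite in_itv/= leey andbT mule_ge0//.
  by apply: integral_ge0 => x _; rewrite lee_fin powR_ge0.
Qed.

Lemma sqintegrable_pullback (f : L2fun) :
  ((fun x => f (h x)) : T -> R[i]^o) \in sqintegrable.
Proof.
have mf := measurable_normc_L2fun f.
case: f mf => f /= /asboolP[mR mI fi] mf; apply/asboolP; split.
- exact: (measurableT_comp mR mh).
- exact: (measurableT_comp mI mh).
apply: (le_lt_trans (enorm2_pullback mf)).
by rewrite lte_mul_pinfty// lee_fin powR_ge0.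
Qed.

End pullback.

End complex_L2.

Section operators.
Context d (T : measurableType d) (R : realType) (mu : {measure set T -> \bar R}).
Implicit Types (A B : set (L2 mu -> L2 mu)).

Definition bounded_operators : set (L2 mu -> L2 mu) :=
  [set S | linear S /\ exists C : R, forall u, L2norm (S u) <= C * L2norm u].

Definition commutant A : set (L2 mu -> L2 mu) :=
  [set S | bounded_operators S /\ forall U, A U -> S \o U = U \o S].

(* The product of operators is composition; sums and scalings are pointwise.
   Subalgebras need be neither unital, nor norm-closed, nor self-adjoint. *)
Definition subalgebra A :=
  [/\ A `<=` bounded_operators, A 0,
      forall (c : R[i]) S U, A S -> A U -> A (c *: S + U) &
      forall S U, A S -> A U -> A (S \o U)].

Definition abelian_set A := forall S U, A S -> A U -> S \o U = U \o S.

Definition maximal_abelian_subalgebra A :=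
  [/\ subalgebra A, abelian_set A &
      forall B, subalgebra B -> abelian_set B -> A `<=` B -> B = A].

End operators.

Section relativistic.
Context (R : realType) (n : nat).

Definition energy (m : R) (p : euclid R n) : R :=
  Num.sqrt (\sum_i coord p i ^+ 2 + m ^+ 2).

Lemma measurable_energy m : measurable_fun setT (energy m).
Proof.
apply: (@measurableT_comp _ _ _ _ _ _ (@Num.sqrt R)).
  by apply: continuous_measurable_fun; exact: sqrt_continuous.
apply: measurable_funD => //; apply: measurable_sum => i.
by apply: measurable_funX; exact: measurable_coord.
Qed.

Lemma measurable_inv_energy m :
  measurable_fun setT (fun p => ((energy m p)^-1)%:E).
Proof.
apply/measurable_EFinP.
rewrite (_ : (fun p => _) = (@powR R ^~ (- 1)) \o energy m); last first.
  by apply/funext => p /=; rewrite powR_inv1// sqrtr_ge0.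
by apply: measurableT_comp => //; exact: measurable_energy.
Qed.

(* The measure dp / E(p). *)
Definition shell_measure (m : R) (A : set (euclid R n)) : \bar R :=
  (\int[@lebesgue_n R n]_(p in A) ((energy m p)^-1)%:E)%E.

Let inv_energy_ge0 m p : (0 <= ((energy m p)^-1)%:E)%E.
Proof. by rewrite lee_fin invr_ge0 sqrtr_ge0. Qed.

Let shell_measure0 m : shell_measure m set0 = 0%E.
Proof. exact: integral_set0. Qed.

Let shell_measure_ge0 m A : (0 <= shell_measure m A)%E.
Proof. by apply: integral_ge0 => p _; exact: inv_energy_ge0. Qed.

Let shell_measure_sigma_additive m : semi_sigma_additive (shell_measure m).
Proof.
exact: (semi_sigma_additive_nng_induced (measurable_inv_energy m)
  (inv_energy_ge0 m)).
Qed.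

HB.instance Definition _ m := isMeasure.Build _ _ _ (shell_measure m)
  (shell_measure0 m) (shell_measure_ge0 m) (@shell_measure_sigma_additive m).

(* A bound for E(q - a) / E(q), which makes translations bounded. *)
Definition shift_const (m : R) (a : euclid R n) : R :=
  Num.sqrt (2 + 2 * (\sum_i coord a i ^+ 2) / m ^+ 2).

Lemma energy_vsub m (a q : euclid R n) : 0 < m ->
  energy m (vsub q a) <= shift_const m a * energy m q.
Proof.
move=> m0.
have s0 (b : euclid R n) : 0 <= \sum_i coord b i ^+ 2.
  by apply: sumr_ge0 => i _; exact: sqr_ge0.
have m20 : 0 < m ^+ 2 by rewrite exprn_gt0.
rewrite /shift_const /energy -sqrtrM; last first.
  by rewrite addr_ge0// divr_ge0// ?mulr_ge0// ltW.
rewrite ler_sqrt; last first.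
  by rewrite mulr_ge0 ?addr_ge0// ?divr_ge0// ?mulr_ge0// ltW.
have H : \sum_i coord (vsub q a) i ^+ 2 <=
    2 * (\sum_i coord q i ^+ 2) + 2 * \sum_i coord a i ^+ 2.
  rewrite !mulr_sumr -big_split/=; apply: ler_sum => i _.
  rewrite {1}/coord tnth_mktuple.
  have := sqr_ge0 (coord q i + coord a i); rewrite !expr2; lra.
rewrite mulrDl [leRHS]addrC mulrDr.
have -> : 2 * (\sum_i coord a i ^+ 2) / m ^+ 2 * m ^+ 2 =
  2 * \sum_i coord a i ^+ 2 by rewrite divfK// gt_eqF.
have H2 : 0 <= 2 * (\sum_i coord a i ^+ 2) / m ^+ 2 * (\sum_i coord q i ^+ 2).
  by rewrite mulr_ge0// divr_ge0 ?mulr_ge0// ltW.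
lra.
Qed.

Context (m : R) (m_gt0 : 0 < m).

Lemma energy_gt0 p : 0 < energy m p.
Proof.
rewrite sqrtr_gt0 ltr_wpDl ?exprn_gt0//.
by apply: sumr_ge0 => i _; exact: sqr_ge0.
Qed.

Lemma shell_measure_vsub (a : euclid R n) A : measurable A ->
  (shell_measure m ((fun p => vsub p a) @^-1` A) <=
   (shift_const m a)%:E * shell_measure m A)%E.
Proof.
move=> mA.
have shift0 : 0 <= shift_const m a by exact: sqrtr_ge0.
have mI := measurable_inv_energy m.
pose tau (p : euclid R n) := vsub p a.
pose nu : {measure set (euclid R n) -> \bar R} := pushforward (@lebesgue_n R n) tau.
have mtau : measurable_fun setT tau by exact: measurable_vsub.
have mtA : measurable (tau @^-1` A).
  by rewrite -[X in measurable X]setTI; exact: mtau.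
apply: (@le_trans _ _ (\int[@lebesgue_n R n]_(p in tau @^-1` A)
   ((fun q => (shift_const m a)%:E * ((energy m q)^-1)%:E) \o tau) p)%E).
  apply: ge0_le_integral => //.
  - exact: measurable_funTS.
  - apply: measurable_funTS; apply: measurableT_comp => //.
    exact: measurable_funeM.
  - move=> p _ /=; rewrite -EFinM lee_fin.
    rewrite ler_pdivlMr ?energy_gt0// mulrC ler_pdivrMr ?energy_gt0//.
    exact: energy_vsub.
rewrite -ge0_integral_pushforward//; last 2 first.
  - by apply: measurable_funTS; exact: measurable_funeM.
  - by move=> p _; rewrite mule_ge0 ?lee_fin// invr_ge0 sqrtr_ge0.
rewrite (@eq_measure_integral _ _ _ _ (@lebesgue_n R n)); last first.
  by move=> B mB _; exact: lebesgue_n_vsub.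
by rewrite ge0_integralZl// ?lee_fin//; exact: measurable_funTS.
Qed.

Lemma sqintegrable_vsub (a : euclid R n) (f : L2fun (shell_measure m)) :
  (fun p => f (vsub p a)) \in sqintegrable (shell_measure m).
Proof.
apply: (sqintegrable_pullback (@measurable_vsub R n a)
  (@shell_measure_vsub a)).
exact: sqrtr_ge0.
Qed.

Definition translate_fun (a : euclid R n) (f : L2fun (shell_measure m)) :
    L2fun (shell_measure m) :=
  MkL2fun (sqintegrable_vsub a f).

(* The translate of a class is the class of the translate of any
   representative: see translation_class. *)
Definition translation (a : euclid R n) (u : L2 (shell_measure m)) :
    L2 (shell_measure m) :=
  L2class (translate_fun a (repr u)).

Lemma translation_class a f :
  translation a (L2class f) = L2class (translate_fun a f).
Proof.
apply/L2class_eqP; apply: (ae_eq_pullback (@measurable_vsub R n a)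
  (@shell_measure_vsub a)).
exact: repr_L2class.
Qed.

Lemma bounded_translation a : bounded_operators (translation a).
Proof.
split.
  move=> c u v; rewrite -[u]L2class_repr -[v]L2class_repr.
  rewrite -L2class_scale -L2classD !translation_class.
  by rewrite -L2class_scale -L2classD; congr L2class; exact/val_inj.
exists (shift_const m a `^ 2^-1) => u; rewrite -[u]L2class_repr.
rewrite translation_class !L2norm_class -lee_fin EFinM.
rewrite !fineK ?enorm2_fin_num//.
by apply: enorm2_pullback;
  [exact: measurable_vsub|exact: shell_measure_vsub|exact: sqrtr_ge0|
   exact: measurable_normc_L2fun].
Qed.

Definition Linfty_r : set (L2 (shell_measure m) -> L2 (shell_measure m)) :=
  commutant (range translation).

End relativistic.

(* Main.v *)
Require Import Defs.
From mathcomp Require Import all_boot all_order all_algebra.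
From mathcomp Require Import all_classical all_reals all_analysis.
From mathcomp Require Import measurable_realfun complex.
From mathcomp Require Import lra ring.
From mathcomp Require Import generic_quotient.
(* Again, so that [coord] is the coordinate of a point of R^n, and not that of a
   vector in a basis. *)
Require Import Defs.
Set Implicit Arguments. Unset Strict Implicit. Unset Printing Implicit Defensive.
Import Order.TTheory GRing.Theory Num.Theory.
Import numFieldNormedType.Exports.
Local Open Scope classical_set_scope.
Local Open Scope ring_scope.

(** Maximality is formal: translations commute with one another, so they belong
   to their own commutant; an abelian algebra containing the commutant then
   consists of operators commuting with translations. The content is that the
   commutant is abelian.

   Without a Fourier transform, the idea is that an operator commuting with
   translations is symmetric for the bilinear form
   [<u, v> = \int u (p) v (- p) dp], the value at the origin of a convolution:
   formally, [<f, S g> = (f * S g) (0) = (S f * g) (0) = <S f, g>]. If every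
   operator of the commutant is symmetric, then for [S] and [U] in it
   [<f, S U g> = <S f, U g> = <U S f, g> = <f, U S g>], because the product
   [U S] is in the commutant as well.

   For indicators of dyadic cubes of the same size, symmetry is elementary: all
   of them are translates of a single function [e], and if [f] and [g] are its
   translates by [x] and [y], then both [<f, S g>] and [<g, S f>] are equal to
   [\int e (p) (S e) (- p - x - y) dp] by invariance of Lebesgue measure
   ([convol_cubeC]). A cube may be cut into the smaller cubes that it contains, so
   the sizes need not agree; and a bounded real-linear
   functional that vanishes on small cubes vanishes everywhere, by the pi-lambda
   theorem and approximation by simple functions ([functional_dyadic_eq0]).

   The form is not defined on the whole of L^2(dp / E(p)), because the weight
   [1 / E] is not bounded below. It is bounded as soon as one argument is cut off
   to a bounded set ([convol]), so symmetry first reads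
   [<f, S (1_D h)> = <1_D h, S f>] for a cube [f] and any [h]
   ([convol_transpose]). Taking [h = U g] and letting [D] run through symmetric
   boxes gives [<f, S U g> = lim <1_D U g, S f>], and in the same way
   [<g, U S f> = lim <1_D S f, U g>]; the two truncated pairings coincide because
   [D] is symmetric ([convol_comm]). Nondegeneracy ([convol_eq0]) and density
   conclude. *)

(** * Squared norms, and classes of functions *)

Section sqnorm.
Context d (T : measurableType d) (R : realType) (mu : {measure set T -> \bar R}).

Definition abs2 (z : R[i]) : R := complex.Re z ^+ 2 + complex.Im z ^+ 2.

Lemma abs2_ge0 z : 0 <= abs2 z.
Proof. by rewrite addr_ge0// sqr_ge0. Qed.

Lemma abs2M z w : abs2 (z * w) = abs2 z * abs2 w.
Proof. case: z => a b; case: w => c e; rewrite /abs2/=; ring. Qed.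

Lemma abs2_real (r : R) : abs2 r%:C%C = r ^+ 2.
Proof. by rewrite /abs2/= expr0n addr0. Qed.

Lemma abs2_eq0 z : abs2 z = 0 -> z = 0.
Proof.
case: z => a b /eqP; rewrite /abs2/= paddr_eq0 ?sqr_ge0// !sqrf_eq0.
by move=> /andP[/eqP -> /eqP ->].
Qed.

Lemma abs2D z w : abs2 (z + w) <= 2 * (abs2 z + abs2 w).
Proof.
case: z => a b; case: w => c e; rewrite /abs2/=.
have := sqr_ge0 (a - c); have := sqr_ge0 (b - e); rewrite !expr2; nra.
Qed.

Lemma normc_sqr z : `|@ComplexField.Normc.normc R z| `^ 2 = abs2 z.
Proof.
rewrite -[2]/(2%:R) powR_mulrn ?normr_ge0// real_normK ?num_real//.
by case: z => a b; rewrite sqr_sqrtr// addr_ge0// sqr_ge0.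
Qed.

Lemma poweR_enorm2 (f : T -> R[i]) :
  (enorm2 mu f `^ 2 = \int[mu]_x (abs2 (f x))%:E)%E.
Proof.
rewrite poweR_Lnorm ?pnatr_eq0//; apply: eq_integral => x _.
by rewrite /= normc_sqr.
Qed.

Lemma measurable_abs2 (f : T -> R[i]) :
  measurable_fun setT (fun x => complex.Re (f x)) ->
  measurable_fun setT (fun x => complex.Im (f x)) ->
  measurable_fun setT (fun x => abs2 (f x)).
Proof. by move=> mR mI; apply: measurable_funD; apply: measurable_funX. Qed.

Lemma sqintegrableP (f : T -> R[i]^o) :
  reflect [/\ measurable_fun setT (fun x => complex.Re (f x)),
    measurable_fun setT (fun x => complex.Im (f x)) &
    mu.-integrable setT (EFin \o (abs2 \o f))] (f \in sqintegrable mu).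
Proof.
have ge0 : (0 <= \int[mu]_x (abs2 (f x))%:E)%E.
  by apply: integral_ge0 => x _; rewrite lee_fin abs2_ge0.
have E : (\int[mu]_x `|(abs2 (f x))%:E| = \int[mu]_x (abs2 (f x))%:E)%E.
  by apply: eq_integral => x _; rewrite gee0_abs// lee_fin abs2_ge0.
apply: (iffP (asboolP _)) => [][mR mI fi]; split => //.
  apply/integrableP; split; first exact/measurable_EFinP/measurable_abs2.
  rewrite /= E -poweR_enorm2.
  have : enorm2 mu f \is a fin_num by rewrite ge0_fin_numE ?Lnorm_ge0.
  by move=> /fineK <-; rewrite poweR_EFin ltry.
move/integrableP : fi => [_]; rewrite /= E => fi.
have : (\int[mu]_x (abs2 (f x))%:E)%E \is a fin_num by rewrite ge0_fin_numE.
have -> : enorm2 mu f = ((\int[mu]_x (abs2 (f x))%:E) `^ 2^-1)%E.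
  rewrite -poweR_enorm2 -poweRrM mulfV ?pnatr_eq0// poweRe1// Lnorm_ge0//.
by move=> /fineK <-; rewrite poweR_EFin ltry.
Qed.

Lemma sqintegrable_le (f : T -> R[i]^o) (g : T -> R) :
  measurable_fun setT (fun x => complex.Re (f x)) ->
  measurable_fun setT (fun x => complex.Im (f x)) ->
  mu.-integrable setT (EFin \o g) -> (forall x, abs2 (f x) <= g x) ->
  f \in sqintegrable mu.
Proof.
move=> mR mI ig fg; apply/sqintegrableP; split => //.
apply: le_integrable ig => //; first exact/measurable_EFinP/measurable_abs2.
move=> x _ /=; rewrite lee_fin ger0_norm ?abs2_ge0//.
exact: le_trans (fg x) (ler_norm _).
Qed.

Definition sqnorm (u : L2 mu) : R := L2norm u ^+ 2.

Lemma sqnorm_ge0 u : 0 <= sqnorm u. Proof. exact: sqr_ge0. Qed.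

Lemma sqnorm_class (f : L2fun mu) : sqnorm (L2class f) = \int[mu]_x abs2 (f x).
Proof.
rewrite /sqnorm L2norm_class /Rintegral -poweR_enorm2.
rewrite -[X in _ = fine (X `^ _)%E](fineK (enorm2_fin_num f)) poweR_EFin/=.
by rewrite -[2 in RHS]/(2%:R) powR_mulrn// fine_ge0// Lnorm_ge0.
Qed.

(** The class of a function, and [0] by convention when the function is not
   square-integrable: a total operation, so that terms carry no proofs. *)
Definition toL2 (f : T -> R[i]^o) : L2 mu := L2class (insubd 0 f).

Lemma toL2E (f : T -> R[i]^o) (fP : f \in sqintegrable mu) :
  toL2 f = L2class (MkL2fun fP).
Proof. by congr L2class; apply/val_inj; rewrite val_insubd fP. Qed.

Lemma repr_sqintegrable (u : L2 mu) : (repr u : T -> R[i]^o) \in sqintegrable mu.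
Proof. exact: L2valP. Qed.

Lemma reprL2K (u : L2 mu) : toL2 (repr u) = u.
Proof.
rewrite (toL2E (repr_sqintegrable u)) -[RHS]L2class_repr.
by congr L2class; apply/val_inj.
Qed.

Lemma repr_toL2 (f : T -> R[i]^o) : f \in sqintegrable mu ->
  (repr (toL2 f) : T -> R[i]^o) = f %[ae mu].
Proof. by move=> fP; rewrite toL2E; exact: repr_L2class. Qed.

Lemma toL2_ae (f g : T -> R[i]^o) : f \in sqintegrable mu ->
  g \in sqintegrable mu -> f = g %[ae mu] -> toL2 f = toL2 g.
Proof. by move=> fP gP fg; rewrite !toL2E; apply/L2class_eqP. Qed.

Lemma toL2D (f g : T -> R[i]^o) : f \in sqintegrable mu ->
  g \in sqintegrable mu -> toL2 (f + g) = toL2 f + toL2 g.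
Proof.
move=> fP gP; have fgP : f + g \in sqintegrable mu by exact: rpredD.
by rewrite !toL2E -L2classD; congr L2class; exact/val_inj.
Qed.

Lemma toL2B (f g : T -> R[i]^o) : f \in sqintegrable mu ->
  g \in sqintegrable mu -> toL2 (f - g) = toL2 f - toL2 g.
Proof.
move=> fP gP; apply/eqP; rewrite eq_sym subr_eq -toL2D//.
  by rewrite subrK.
exact: rpredB.
Qed.

Lemma toL2Z (c : R[i]) (f : T -> R[i]^o) : f \in sqintegrable mu ->
  toL2 (c *: f) = c *: toL2 f.
Proof.
move=> fP; have cfP : c *: f \in sqintegrable mu by exact: rpredZ.
by rewrite !toL2E -L2class_scale; congr L2class; exact/val_inj.
Qed.

Lemma toL20 : toL2 0 = 0.
Proof. by rewrite -(subrr (0 : T -> R[i]^o)) toL2B ?rpred0// subrr. Qed.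

Lemma sqnorm_toL2 (f : T -> R[i]^o) : f \in sqintegrable mu ->
  sqnorm (toL2 f) = \int[mu]_x abs2 (f x).
Proof. by move=> fP; rewrite toL2E sqnorm_class. Qed.

Lemma sqnorm_repr u : sqnorm u = \int[mu]_x abs2 (repr u x).
Proof. by rewrite -{1}[u]reprL2K sqnorm_toL2// repr_sqintegrable. Qed.

Lemma sqnorm0 : sqnorm 0 = 0.
Proof.
rewrite -toL20 sqnorm_toL2 ?rpred0//.
rewrite (_ : (fun x => _) = cst 0) ?Rintegral_cst ?mul0r//.
by apply/funext => x; rewrite /abs2/= expr0n addr0.
Qed.

Lemma sqnormZ (c : R[i]) u : sqnorm (c *: u) = abs2 c * sqnorm u.
Proof.
rewrite -{1}[u]reprL2K -toL2Z ?repr_sqintegrable//.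
rewrite sqnorm_toL2 ?rpredZ ?repr_sqintegrable// sqnorm_repr -RintegralZl//.
  by apply: eq_Rintegral => x _; rewrite -[X in abs2 X]/(_ * _) abs2M.
by have /sqintegrableP[] := repr_sqintegrable u.
Qed.

Lemma sqnormD u v : sqnorm (u + v) <= 2 * (sqnorm u + sqnorm v).
Proof.
have uP := repr_sqintegrable u; have vP := repr_sqintegrable v.
rewrite -[u]reprL2K -[v]reprL2K -toL2D// !sqnorm_toL2 ?rpredD//.
have /sqintegrableP[_ _ ui] := uP; have /sqintegrableP[_ _ vi] := vP.
rewrite -RintegralD// -RintegralZl//; last exact: (integrableD measurableT ui vi).
apply: le_Rintegral => //.
- by have /sqintegrableP[] := rpredD uP vP.
- exact: (integrableZl measurableT 2 (integrableD measurableT ui vi)).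
- by move=> x _; exact: abs2D.
Qed.

Lemma sqnorm_bounded (S : L2 mu -> L2 mu) : bounded_operators S ->
  exists C : R, 0 <= C /\ forall u, sqnorm (S u) <= C * sqnorm u.
Proof.
move=> [_ [C SC]]; exists (C ^+ 2); split; first exact: sqr_ge0.
have n0 (v : L2 mu) : 0 <= L2norm v by rewrite fine_ge0// Lnorm_ge0.
by move=> u; rewrite /sqnorm -exprMn lerXn2r ?nnegrE// (le_trans (n0 _) (SC u)).
Qed.

(** Squared norms are integrals, so that sums of operators are bounded through
   the pointwise inequality [abs2D]. *)
Lemma bounded_sqnorm (S : L2 mu -> L2 mu) C :
  (forall u, sqnorm (S u) <= C * sqnorm u) ->
  exists K : R, forall u, L2norm (S u) <= K * L2norm u.
Proof.
move=> SC; exists (Num.sqrt C) => u.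
have n0 (v : L2 mu) : 0 <= L2norm v by rewrite fine_ge0// Lnorm_ge0.
have := ler_wsqrtr (SC u); rewrite /sqnorm sqrtr_sqr ger0_norm//.
move=> /le_trans; apply; have [C0|C0] := leP 0 C.
  by rewrite sqrtrM// sqrtr_sqr ger0_norm.
rewrite ler0_sqrtr ?mulr_ge0 ?sqrtr_ge0//.
by rewrite mulr_le0_ge0 ?sqr_ge0// ltW.
Qed.

End sqnorm.
Arguments abs2 {R} z.
(** * Bounded real functionals on L^2 *)

Section real_functional.
Context d (T : measurableType d) (R : realType) (mu : {measure set T -> \bar R}).
Implicit Types (L : L2 mu -> R) (f : T -> R[i]^o) (c : R[i]).

(** The bound need not be homogeneous: together with homogeneity it gives
   continuity, and it is the form in which polarised estimates such as
   [2 |a b| <= a ^ 2 + b ^ 2] provide it. *)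
Definition real_functional L :=
  [/\ {morph L : u v / u + v}, forall (r : R) u, L (r%:C%C *: u) = r * L u &
      exists C, forall u, `|L u| <= C * (1 + sqnorm u)].

Lemma functionalN L u : real_functional L -> L (- u) = - L u.
Proof.
move=> [_ LZ _]; have := LZ (-1) u; rewrite mulN1r => <-.
by rewrite (rmorphN1 (real_complex R)) scaleN1r.
Qed.

Lemma functionalB L u v : real_functional L -> L (u - v) = L u - L v.
Proof. by move=> rL; rewrite -(functionalN v rL); case: rL => ->. Qed.

Lemma functional0 L : real_functional L -> L 0 = 0.
Proof. by move=> rL; rewrite -(subrr 0) functionalB// subrr. Qed.

Lemma functional_sub K L : real_functional K -> real_functional L ->
  real_functional (fun u => K u - L u).
Proof.
move=> [D1 Z1 [C1 H1]] [D2 Z2 [C2 H2]]; split.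
- by move=> u v; rewrite D1 D2; ring.
- by move=> r u; rewrite Z1 Z2; ring.
- exists (C1 + C2) => u; rewrite mulrDl.
  by apply: (le_trans (ler_normB _ _)); exact: lerD.
Qed.

Lemma operatorD (S : L2 mu -> L2 mu) u v : bounded_operators S ->
  S (u + v) = S u + S v.
Proof. by move=> [Slin _]; have := Slin 1 u v; rewrite !scale1r. Qed.

Lemma operator0 (S : L2 mu -> L2 mu) : bounded_operators S -> S 0 = 0.
Proof.
move=> SB; have := operatorD 0 0 SB; rewrite addr0 => S0.
by apply: (@addrI _ (S 0)); rewrite addr0 -S0.
Qed.

Lemma operatorZ (S : L2 mu -> L2 mu) (a : R[i]) u : bounded_operators S ->
  S (a *: u) = a *: S u.
Proof.
by move=> SB; have [Slin _] := SB; have := Slin a u 0; rewrite (operator0 SB) !addr0.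
Qed.

Lemma functional_comp L (S : L2 mu -> L2 mu) :
  real_functional L -> bounded_operators S -> real_functional (L \o S).
Proof.
move=> [LD LZ [C LC]] SB; have [K [K0 SK]] := sqnorm_bounded SB.
have q0 u : 0 <= sqnorm (mu := mu) u by exact: sqnorm_ge0.
have C0 : 0 <= C.
  have := LC 0; rewrite sqnorm0 addr0 mulr1; exact: le_trans.
split => [u v /=|r u /=|].
- by rewrite operatorD// LD.
- by rewrite operatorZ// LZ.
exists (C * (1 + K)) => u; apply: (le_trans (LC _)).
rewrite -mulrA ler_wpM2l//; have := SK u; have := q0 u; nra.
Qed.

Lemma functional_small L : real_functional L -> forall e, 0 < e ->
  exists2 dl, 0 < dl & forall u, sqnorm u < dl -> `|L u| < e.
Proof.
move=> [_ LZ [C LC]] e e0; pose K := `|C| + 1.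
have K0 : 0 < K by rewrite ltr_wpDl.
have LK u : `|L u| <= K * (1 + sqnorm u).
  apply: (le_trans (LC u)); rewrite ler_wpM2r ?addr_ge0 ?sqnorm_ge0//.
  by rewrite (le_trans (ler_norm C))// lerDl.
(* homogeneity turns the bound into |L u| <= K / t + K t |u|^2 *)
pose t := 2 * K / e; have t0 : 0 < t by rewrite divr_gt0// mulr_gt0.
exists (t ^- 2); first by rewrite invr_gt0 exprn_gt0.
move=> u qu; rewrite -(ltr_pM2l t0).
have -> : t * `|L u| = `|L (t%:C%C *: u)| by rewrite LZ normrM gtr0_norm.
apply: (le_lt_trans (LK _)); rewrite sqnormZ abs2_real.
have -> : t * e = K * (1 + 1) by rewrite /t divfK ?gt_eqF//; ring.
rewrite ltr_pM2l// ltrD2l -[ltRHS](@divff _ (t ^+ 2)) ?expf_neq0 ?gt_eqF//.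
by rewrite ltr_pM2l// exprn_gt0.
Qed.

(** Dominated convergence makes the squared norms of the differences vanish. *)
Lemma functional_cvg L (f_ : nat -> T -> R[i]^o) f (g : T -> R) :
  real_functional L -> (forall k, f_ k \in sqintegrable mu) ->
  f \in sqintegrable mu -> mu.-integrable setT (EFin \o g) ->
  (forall k x, abs2 (f x - f_ k x) <= g x) ->
  (forall x, abs2 (f x - f_ k x) @[k --> \oo] --> 0) ->
  L (toL2 mu (f_ k)) @[k --> \oo] --> L (toL2 mu f).
Proof.
move=> rL f_P fP ig leg cvg0.
have dP k : f - f_ k \in sqintegrable mu by exact: rpredB.
have : sqnorm (toL2 mu (f - f_ k)) @[k --> \oo] --> 0.
  have := @dominated_cvg _ T R mu setT measurableT
    (fun k x => (abs2 (f x - f_ k x))%:E) (cst 0%E) (EFin \o g).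
  rewrite integral0 => /(_ _ _ _ _ _)H.
  apply: (@cvg_trans _ (fine (\int[mu]_x (abs2 (f x - f_ k x))%:E)%E @[k --> \oo])).
    by apply: near_eq_cvg; apply: nearW => k; rewrite sqnorm_toL2.
  apply: fine_cvg; apply: H => //.
  - by move=> k; have /sqintegrableP[mR mI _] := dP k;
      exact/measurable_EFinP/measurable_abs2.
  - by move=> x _; apply: cvg_EFin; [exact: nearW|exact: cvg0].
  - by move=> k x _; rewrite gee0_abs lee_fin ?abs2_ge0.
move=> sq0; apply/cvgrPdist_lt => e e0.
have [dl dl0 small] := functional_small rL e0.
move/cvgrPdist_lt : sq0 => /(_ _ dl0) sq0.
apply: filterS sq0 => k; rewrite sub0r normrN ger0_norm ?sqnorm_ge0// => sk.
by rewrite -functionalB// -toL2B//; exact: small.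
Qed.

Lemma functional_cvg0 L (f_ : nat -> T -> R[i]^o) f (g : T -> R) :
  real_functional L -> (forall k, f_ k \in sqintegrable mu) ->
  f \in sqintegrable mu -> mu.-integrable setT (EFin \o g) ->
  (forall k x, abs2 (f x - f_ k x) <= g x) ->
  (forall x, abs2 (f x - f_ k x) @[k --> \oo] --> 0) ->
  (forall k, L (toL2 mu (f_ k)) = 0) -> L (toL2 mu f) = 0.
Proof.
move=> rL f_P fP ig leg cvg0 L0; have := functional_cvg rL f_P fP ig leg cvg0.
rewrite (_ : (fun k => _) = cst 0); last exact/funext.
by move/(cvg_unique (@Rhausdorff R)); move=> /(_ 0 (cvg_cst _))<-.
Qed.

Definition cindic c (A : set T) : T -> R[i]^o := fun x => c * (\1_A x)%:C%C.

Lemma abs2_cindic c A x : abs2 (cindic c A x) = abs2 c * \1_A x.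
Proof.
by rewrite abs2M abs2_real indicE; case: (x \in A); rewrite ?expr1n// expr0n.
Qed.

Lemma integrable_cst_indic (r : R) A : measurable A -> (mu A < +oo)%E ->
  mu.-integrable setT (EFin \o (fun x => r * \1_A x)).
Proof.
move=> mA finA; rewrite (_ : _ \o _ = (fun x => r%:E * (EFin \o \1_A) x)%E)//.
apply: integrableZl => //; apply/integrableP; split; first exact/measurable_EFinP.
under eq_integral do rewrite gee0_abs ?lee_fin//.
by rewrite integral_indic// setIT.
Qed.

Lemma Re_mulr_real (z : R[i]) (r : R) : complex.Re (z * r%:C%C) = complex.Re z * r.
Proof. by case: z => a b /=; ring. Qed.

Lemma Im_mulr_real (z : R[i]) (r : R) : complex.Im (z * r%:C%C) = complex.Im z * r.
Proof. by case: z => a b /=; ring. Qed.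

Lemma sqintegrable_cindic c A : measurable A -> (mu A < +oo)%E ->
  cindic c A \in sqintegrable mu.
Proof.
move=> mA finA.
apply: (sqintegrable_le _ _ (integrable_cst_indic (abs2 c) mA finA)).
- rewrite (_ : (fun x => _) = (fun x => complex.Re c * \1_A x)).
    by apply: measurable_funM => //; exact: measurable_indic.
  by apply/funext => x; rewrite Re_mulr_real.
- rewrite (_ : (fun x => _) = (fun x => complex.Im c * \1_A x)).
    by apply: measurable_funM => //; exact: measurable_indic.
  by apply/funext => x; rewrite Im_mulr_real.
- by move=> x; rewrite abs2_cindic.
Qed.

Lemma cindic0 c : cindic c set0 = 0.
Proof. by apply/funext => x; rewrite /cindic indic0 mulr0. Qed.

Lemma cindicU c A B : [disjoint A & B] -> cindic c (A `|` B) = cindic c A + cindic c B.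
Proof.
move=> /disj_setPS AB; apply/funext => x.
rewrite -[RHS]/(_ + _ : R[i]) /cindic -mulrDr -rmorphD/= !indicE in_setU.
congr (_ * _%:C)%C; case: (boolP (x \in A)) => xA; rewrite ?add0r//.
case: (boolP (x \in B)) => xB; rewrite ?addr0//.
by exfalso; apply: (AB x); split; exact: set_mem.
Qed.

(** The indicators of the finite unions converge in L^2 to that of the whole
   union, which dominates them and is square-integrable by finiteness of its
   measure. *)
Lemma functional_bigcup L c (F : nat -> set T) : real_functional L ->
  (forall k, measurable (F k)) -> trivIset setT F ->
  (mu (\bigcup_k F k) < +oo)%E ->
  (forall k, L (toL2 mu (cindic c (F k))) = 0) ->
  L (toL2 mu (cindic c (\bigcup_k F k))) = 0.
Proof.
move=> rL mF tF finF LF; pose U k := \big[setU/set0]_(i < k) F i.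
have mU k : measurable (U k) by apply: bigsetU_measurable.
have UF k : U k `<=` \bigcup_i F i.
  by move=> x; rewrite /U -bigcup_mkord => -[i _ Fx]; exists i.
have mbF : measurable (\bigcup_i F i) by exact: bigcup_measurable.
have finU k : (mu (U k) < +oo)%E.
  by apply: le_lt_trans finF; rewrite le_measure ?inE.
have E k x : cindic c (\bigcup_i F i) x - cindic c (U k) x =
    cindic c (\bigcup_i F i `\` U k) x.
  rewrite /cindic -mulrBr -rmorphB/=; congr (_ * _%:C)%C.
  rewrite !indicE in_setD.
  case: (boolP (x \in U k)) => [xU|_]; last by rewrite subr0 andbT.
  by rewrite mem_set ?subrr//; exact: (UF k _ (set_mem xU)).
apply: (functional_cvg0 (f_ := fun k => cindic c (U k)) (g := fun x =>
    abs2 c * \1_(\bigcup_k F k) x) rL).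
- by move=> k; exact: sqintegrable_cindic.
- exact: sqintegrable_cindic.
- exact: integrable_cst_indic.
- move=> k x; rewrite E abs2_cindic ler_wpM2l ?abs2_ge0// !indicE in_setD.
  by rewrite ler_nat; case: (x \in \bigcup_k F k) => //=; case: (_ \in _).
- move=> x; apply: cvg_near_cst.
  have [[i _ Fix]|nF] := pselect ((\bigcup_k F k) x).
    exists i.+1 => //= k ik; rewrite E abs2_cindic indicE memNset ?mulr0//.
    by move=> [_]; apply; rewrite /U -bigcup_mkord; exists i.
  apply: nearW => k; rewrite E abs2_cindic indicE memNset ?mulr0//.
  by case.
- move=> k; rewrite /U; elim: k => [|k IH].
    by rewrite big_ord0 cindic0 toL20 functional0.
  rewrite big_ord_recr/= cindicU; last first.
    apply/disj_set2P; apply: (@trivIset_bigsetUI _ predT F) => //.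
    by move: tF; congr trivIset; apply/seteqP; split.
  rewrite toL2D; last 2 first.
    exact: (sqintegrable_cindic c (mU k) (finU k)).
    apply: sqintegrable_cindic => //; apply: le_lt_trans finF.
    by rewrite le_measure ?inE//; exact: bigcup_sup.
  by case: (rL) => -> _ _; rewrite IH LF addr0.
Qed.

(** The sets [A] such that the functional vanishes on [A `&` D] form a Dynkin
   system, by [functional_bigcup]. *)
Lemma functional_eq0_indic L c (G : set (set T)) (D : set T) :
  real_functional L -> @measurable _ T = <<s G >> -> setI_closed G ->
  measurable D -> (mu D < +oo)%E -> L (toL2 mu (cindic c D)) = 0 ->
  (forall A, G A -> L (toL2 mu (cindic c (A `&` D))) = 0) ->
  forall A, measurable A -> L (toL2 mu (cindic c (A `&` D))) = 0.
Proof.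
move=> rL GE GI mD finD LD LG A mA.
have fin B : measurable B -> (mu (B `&` D) < +oo)%E.
  by move=> mB; apply: le_lt_trans finD;
    rewrite le_measure ?inE//; exact: measurableI.
have sq B : measurable B -> cindic c (B `&` D) \in sqintegrable mu.
  by move=> mB; apply: sqintegrable_cindic; [exact: measurableI|exact: fin].
have mA' : (<<s G >>) A by rewrite -GE.
pose P (B : set T) := L (toL2 mu (cindic c (B `&` D))) = 0.
apply: (@dynkin_induction _ T G P GE GI _ _ _ _ A mA') => //; rewrite /P.
- by rewrite setTI.
- move=> B mB LB.
  have : cindic c D = cindic c (B `&` D) + cindic c (~` B `&` D).
    rewrite -cindicU -?setIUl ?setUCr ?setTI//.
    by apply/disj_setPS => x [[Bx _] []].
  move=> DE; move: LD; rewrite DE toL2D ?sq//; last exact: measurableC.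
  by case: (rL) => -> _ _; rewrite LB add0r.
- move=> F mF tF LF; rewrite setI_bigcupl; apply: functional_bigcup => //.
  + by move=> k; exact: measurableI.
  + by apply: trivIset_setIr.
  + by rewrite -setI_bigcupl; apply: fin; exact: bigcup_measurable.
Qed.

End real_functional.
(** * Density of indicators in L^2 *)

Section density.
Context d (T : measurableType d) (R : realType) (mu : {measure set T -> \bar R}).
Implicit Types (L : L2 mu -> R) (f : T -> R[i]^o) (c : R[i]).
Import HBNNSimple.

Lemma functional_simple L c (s : {nnsfun T >-> R}) (D : set T) :
  real_functional L -> measurable D -> (mu D < +oo)%E ->
  (forall A, measurable A -> L (toL2 mu (cindic c (A `&` D))) = 0) ->
  (fun x => c * (s x * \1_D x)%:C%C : R[i]^o) \in sqintegrable mu /\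
  L (toL2 mu (fun x => c * (s x * \1_D x)%:C%C)) = 0.
Proof.
move=> rL mD finD L0; pose A y := s @^-1` [set y] `&` D.
have mA y : measurable (A y) by exact: measurableI.
have sqA y : cindic c (A y) \in sqintegrable mu.
  apply: sqintegrable_cindic => //; apply: le_lt_trans finD.
  by rewrite le_measure ?inE//; exact: subIsetr.
have -> : (fun x => c * (s x * \1_D x)%:C%C : R[i]^o) =
    \sum_(y <- finmap.enum_fset (fset_set (range s))) (y%:C%C *: cindic c (A y)).
  apply/funext => x; rewrite fct_sumE [s x]fimfunE fsbig_finite//= mulr_suml.
  rewrite rmorph_sum/= mulr_sumr; apply: eq_bigr => y _.
  rewrite -[RHS]/(_ * (c * _)) mulrCA -rmorphM/=.
  by congr (_ * _%:C%C); rewrite /A indicI/= mulrA.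
elim: (finmap.enum_fset _) => [|y r [IH1 IH2]].
  by rewrite big_nil rpred0 toL20 functional0.
have sqy : y%:C%C *: cindic c (A y) \in sqintegrable mu by exact: rpredZ.
rewrite big_cons; split; first exact: rpredD.
rewrite toL2D// toL2Z//.
by case: (rL) => -> -> _; rewrite IH2 L0// mulr0 addr0.
Qed.

Section exhaustion.
Variable D : nat -> set T.
Hypotheses (mD : forall k, measurable (D k)) (finD : forall k, (mu (D k) < +oo)%E).
Hypotheses (ndD : forall i j, (i <= j)%N -> D i `<=` D j)
  (UD : \bigcup_k D k = setT).

Lemma indic_exhaustion x : \forall k \near \oo, \1_(D k) x = 1 :> R.
Proof.
have : (\bigcup_k D k) x by rewrite UD.
move=> [i _ Dix]; exists i => //= k ik.
by rewrite indicE mem_set//; exact: ndD ik _ Dix.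
Qed.

(** Simple approximations of [h], cut off to [D k], are dominated by [h] and
   converge to it. *)
Lemma functional_nneg L c (h : T -> R) :
  real_functional L -> measurable_fun setT h -> (forall x, 0 <= h x) ->
  (fun x => c * (h x)%:C%C : R[i]^o) \in sqintegrable mu ->
  (forall k A, measurable A -> L (toL2 mu (cindic c (A `&` D k))) = 0) ->
  L (toL2 mu (fun x => c * (h x)%:C%C)) = 0.
Proof.
move=> rL mh h0 hP L0.
have mEh : measurable_fun setT (EFin \o h) by exact/measurable_EFinP.
pose s := nnsfun_approx measurableT mEh.
have s_h k x : s k x <= h x.
  rewrite -lee_fin /s nnsfun_approxE; apply: (le_approx (D := setT)) => //.
  by move=> y _; rewrite lee_fin.
have fP k := functional_simple (s k) rL (mD k) (finD k) (L0 k).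
have E k x : abs2 (c * (h x)%:C%C - c * (s k x * \1_(D k) x)%:C%C) =
    abs2 c * (h x - s k x * \1_(D k) x) ^+ 2.
  by rewrite -mulrBr -rmorphB/= abs2M abs2_real.
apply: (functional_cvg0 (f_ := fun k x => c * (s k x * \1_(D k) x)%:C%C)
    (g := fun x => abs2 (c * (h x)%:C%C)) rL) => //.
- by move=> k; have [] := fP k.
- by have /sqintegrableP[] := hP.
- move=> k x; rewrite E abs2M abs2_real ler_wpM2l ?abs2_ge0//.
  have sk0 : 0 <= s k x by [].
  rewrite lerXn2r ?nnegrE//.
    by rewrite subr_ge0 indicE; case: (_ \in _); rewrite ?mulr1// mulr0.
  by rewrite lerBlDr lerDl mulr_ge0// indicE.
- move=> x.
  have H : h x - s k x * \1_(D k) x @[k --> \oo] --> 0.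
    rewrite -(subrr (h x)); apply: cvgB; first exact: cvg_cst.
    apply: (@cvg_trans _ (s k x @[k --> \oo])).
      apply: near_eq_cvg; apply: filterS (indic_exhaustion x) => k ->.
      by rewrite mulr1.
    have := @cvg_nnsfun_approx _ _ _ _ measurableT _ mEh (fun x _ => h0 x) x I.
    exact: (@fine_cvg _ _ _ _ (fun k => (s k x)%:E)).
  have := cvgM (cvg_cst (abs2 c)) (cvgM H H); rewrite !mulr0 => H2.
  under eq_fun do rewrite E expr2; exact: H2.
- by move=> k; have [] := fP k.
Qed.

(** Functionals being only real-linear, indicators are needed with both
   coefficients [1] and ['i]; the real and imaginary parts then split into
   differences of nonnegative functions. *)
Lemma functional_eq0 L : real_functional L ->
  (forall c, c = 1 \/ c = 'i%C -> forall k A, measurable A ->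
    L (toL2 mu (cindic c (A `&` D k))) = 0) ->
  forall u, L u = 0.
Proof.
move=> rL L0 u; rewrite -[u]reprL2K.
have /sqintegrableP[mR mI fi] := repr_sqintegrable u.
pose pos (h : T -> R) x : R := Num.max (h x) 0.
pose neg (h : T -> R) x : R := Num.max (- h x) 0.
have L00 (h : T -> R) : measurable_fun setT h ->
    (forall x, h x ^+ 2 <= abs2 (repr u x)) -> forall c, c = 1 \/ c = 'i%C ->
    (fun x => c * (h x)%:C%C : R[i]^o) \in sqintegrable mu /\
    L (toL2 mu (fun x => c * (h x)%:C%C)) = 0.
  move=> mh hu c c1i.
  have mp : measurable_fun setT (pos h) by apply: measurable_maxr.
  have mn : measurable_fun setT (neg h).
    by apply: measurable_maxr => //; exact: measurableT_comp.
  have p0 x : 0 <= pos h x by rewrite le_max lexx orbT.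
  have n0 x : 0 <= neg h x by rewrite le_max lexx orbT.
  have sqk (k : T -> R) : measurable_fun setT k -> (forall x, k x ^+ 2 <= h x ^+ 2) ->
      (fun x => c * (k x)%:C%C : R[i]^o) \in sqintegrable mu.
    move=> mk kh; apply: (sqintegrable_le _ _ fi).
    - under eq_fun do rewrite Re_mulr_real; exact: measurable_funM.
    - under eq_fun do rewrite Im_mulr_real; exact: measurable_funM.
    - move=> x; rewrite abs2M abs2_real (_ : abs2 c = 1) ?mul1r.
        exact: le_trans (hu x).
      by case: c1i => ->; rewrite /abs2/=; ring.
  have max0 (a : R) : Num.max a 0 ^+ 2 <= a ^+ 2.
    by rewrite /Order.max; case: ifP => _; rewrite ?lexx// expr0n sqr_ge0.
  have ph x : pos h x ^+ 2 <= h x ^+ 2 by exact: max0.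
  have nh x : neg h x ^+ 2 <= h x ^+ 2 by rewrite -[leRHS]sqrrN; exact: max0.
  have -> : (fun x => c * (h x)%:C%C : R[i]^o) =
      (fun x => c * (pos h x)%:C%C : R[i]^o) - (fun x => c * (neg h x)%:C%C : R[i]^o).
    apply/funext => x; rewrite -[RHS]/(_ - _ : R[i]) -mulrBr -rmorphB/=.
    congr (_ * _%:C)%C; rewrite /pos /neg /Order.max.
    case: (ltgtP (h x) 0) => [h0|h0|->]; rewrite oppr_lt0.
    - by rewrite (lt_gtF h0) sub0r opprK.
    - by rewrite h0 subr0.
    - by rewrite ltxx oppr0 subr0.
  have P1 := sqk _ mp ph; have P2 := sqk _ mn nh.
  split; first exact: rpredB.
  rewrite toL2B// functionalB// !functional_nneg ?subrr//.
  - by move=> k A mA; exact: L0.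
  - by move=> k A mA; exact: L0.
have hR x : complex.Re (repr u x) ^+ 2 <= abs2 (repr u x).
  by rewrite lerDl sqr_ge0.
have hI x : complex.Im (repr u x) ^+ 2 <= abs2 (repr u x).
  by rewrite lerDr sqr_ge0.
have [sR LR] := L00 _ mR hR 1 (or_introl erefl).
have [sI LI] := L00 _ mI hI 'i%C (or_intror erefl).
have -> : (repr u : T -> R[i]^o) =
    (fun x => 1 * (complex.Re (repr u x))%:C%C : R[i]^o) +
    (fun x => 'i%C * (complex.Im (repr u x))%:C%C : R[i]^o).
  apply/funext => x; rewrite -[RHS]/(_ + _ : R[i]).
  by case: (repr u x) => a b /=; congr Complex; rewrite /=; ring.
by rewrite toL2D//; case: (rL) => -> _ _; rewrite LR LI addr0.
Qed.

End exhaustion.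
End density.
(** * The real bilinear form of a dominated measure *)

(** Here [nu] stands for Lebesgue measure on a bounded set [D] and [mu] for the
   measure [dp / E(p)]: locally, [nu] is at most a multiple of [mu], so that
   functions of L^2(mu) can be paired for [nu] on [D]. *)
Section pairing.
Context d (T : measurableType d) (R : realType) (mu nu : {measure set T -> \bar R}).
Variables (D : set T) (C : R).
Hypotheses (mD : measurable D) (C0 : 0 <= C)
  (dom : forall A, measurable A -> (nu (A `&` D) <= C%:E * mu A)%E).
Implicit Types (f g : T -> R[i]^o) (u v : L2 mu).

(** The real part loses nothing: the imaginary part is recovered by multiplying
   one argument by ['i]. *)
Definition pairing (f g : T -> R[i]) : R :=
  \int[nu]_(x in D) complex.Re (f x * g x).

Definition L2pairing u v : R := pairing (repr u) (repr v).

Lemma pairingC f g : pairing f g = pairing g f.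
Proof. by apply: eq_Rintegral => x _; rewrite mulrC. Qed.

Lemma L2pairingC u v : L2pairing u v = L2pairing v u.
Proof. exact: pairingC. Qed.

Lemma dominated_integral (h : T -> \bar R) : measurable_fun setT h ->
  (forall x, 0 <= h x)%E -> (\int[nu]_(x in D) h x <= C%:E * \int[mu]_x h x)%E.
Proof.
move=> mh h0; have -> : (\int[nu]_(x in D) h x = \int[mrestr nu mD]_(x in D) h x)%E.
  by apply: eq_measure_integral => A mA AD; rewrite /= /mrestr setIidl.
rewrite -(ge0_integral_mscale _ _ (NngNum C0))//.
apply: (@le_trans _ _ (\int[mscale (NngNum C0) mu]_(x in D) h x)%E).
  exact: ge0_le_measure_integral.
apply: ge0_subset_integral => //.
Qed.

Lemma integrable_abs2_dominated f : f \in sqintegrable mu ->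
  nu.-integrable D (EFin \o (abs2 \o f)).
Proof.
move=> /sqintegrableP[mR mI /integrableP[_ fi]].
have mf : measurable_fun setT (EFin \o (abs2 \o f)).
  exact/measurable_EFinP/measurable_abs2.
apply/integrableP; split; first exact: measurable_funTS.
apply: (le_lt_trans (dominated_integral _ _)) => //.
  exact: measurableT_comp.
by rewrite lte_mul_pinfty.
Qed.

Lemma Re_mul_le (z w : R[i]) : `|complex.Re (z * w)| <= abs2 z + abs2 w.
Proof.
case: z => a b; case: w => c e; rewrite /abs2/= ler_norml.
have := sqr_ge0 (a - c); have := sqr_ge0 (b - e); have := sqr_ge0 (a + c).
have := sqr_ge0 (b + e); have := sqr_ge0 a; have := sqr_ge0 b.
have := sqr_ge0 c; have := sqr_ge0 e; rewrite !expr2 => *; apply/andP; split; lra.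
Qed.

Lemma measurable_Re_mul f g : f \in sqintegrable mu -> g \in sqintegrable mu ->
  measurable_fun setT (fun x => complex.Re (f x * g x)).
Proof.
move=> /sqintegrableP[mRf mIf _] /sqintegrableP[mRg mIg _].
rewrite (_ : (fun x => _) = fun x => complex.Re (f x) * complex.Re (g x) -
    complex.Im (f x) * complex.Im (g x)).
  by apply: measurable_funB; exact: measurable_funM.
by apply/funext => x; case: (f x) => a b; case: (g x).
Qed.

Lemma integrable_pairing f g : f \in sqintegrable mu -> g \in sqintegrable mu ->
  nu.-integrable D (EFin \o (fun x => complex.Re (f x * g x))).
Proof.
move=> fP gP; have fgi := integrableD mD (integrable_abs2_dominated fP)
  (integrable_abs2_dominated gP).
apply: le_integrable fgi => //.
  by apply/measurable_EFinP/measurable_funTS; exact: measurable_Re_mul.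
move=> x _ /=; rewrite lee_fin; apply: (le_trans (Re_mul_le _ _)).
exact: ler_norm.
Qed.

Lemma pairing_ae f f' g g' :
  f \in sqintegrable mu -> f' \in sqintegrable mu ->
  g \in sqintegrable mu -> g' \in sqintegrable mu ->
  f = f' %[ae mu] -> g = g' %[ae mu] -> pairing f g = pairing f' g'.
Proof.
move=> fP fP' gP gP' ff gg; congr fine; apply: ae_eq_integral => //.
- by apply/measurable_EFinP/measurable_funTS; exact: measurable_Re_mul.
- by apply/measurable_EFinP/measurable_funTS; exact: measurable_Re_mul.
have [N [mN N0 fgN]] : {ae mu, forall x, f x * g x = f' x * g' x :> R[i]}.
  by apply: filterS2 ff gg => x /(_ I) -> /(_ I) ->.
exists (N `&` D); split.
- exact: measurableI.
- by apply/eqP; rewrite -measure_le0 (le_trans (dom mN))// N0 mule0.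
- move=> x /= H; apply: contrapT => /not_andP[Nx|Dx].
    by apply: H => _; congr (complex.Re _)%:E; apply: contrapT => H; apply/Nx/fgN.
  by apply: H => /Dx.
Qed.

Lemma L2pairing_toL2 f g : f \in sqintegrable mu -> g \in sqintegrable mu ->
  L2pairing (toL2 mu f) (toL2 mu g) = pairing f g.
Proof.
by move=> fP gP; apply: pairing_ae; rewrite ?repr_sqintegrable//; exact: repr_toL2.
Qed.

Lemma pairingDl f f' g : f \in sqintegrable mu -> f' \in sqintegrable mu ->
  g \in sqintegrable mu -> pairing (f + f') g = pairing f g + pairing f' g.
Proof.
move=> fP fP' gP; rewrite -RintegralD//; try exact: integrable_pairing.
apply: eq_Rintegral => x _; rewrite -[(f + f') x]/(f x + f' x : R[i]) mulrDl.
by case: (f x * g x); case: (f' x * g x).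
Qed.

Lemma L2pairingDl u u' v : L2pairing (u + u') v = L2pairing u v + L2pairing u' v.
Proof.
rewrite -[u]reprL2K -[u']reprL2K -[v]reprL2K -toL2D ?repr_sqintegrable//.
by rewrite !L2pairing_toL2 ?rpredD ?repr_sqintegrable// pairingDl ?repr_sqintegrable.
Qed.

Lemma L2pairingZl (r : R) u v : L2pairing (r%:C%C *: u) v = r * L2pairing u v.
Proof.
rewrite -[u]reprL2K -[v]reprL2K -!toL2Z ?repr_sqintegrable//.
rewrite !L2pairing_toL2 ?rpredZ ?repr_sqintegrable//.
rewrite -RintegralZl//; last by apply: integrable_pairing; exact: repr_sqintegrable.
apply: eq_Rintegral => x _; rewrite -[(_ *: _ : T -> _) x]/(r%:C%C * _ : R[i]).
by rewrite -mulrA mulrC Re_mulr_real mulrC.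
Qed.

Lemma L2pairing_bound u v : `|L2pairing u v| <= C * (sqnorm u + sqnorm v).
Proof.
have uP := repr_sqintegrable u; have vP := repr_sqintegrable v.
have iu := integrable_abs2_dominated uP.
have iv := integrable_abs2_dominated vP.
have bd (w : L2 mu) : \int[nu]_(x in D) abs2 (repr w x) <= C * sqnorm w.
  have /sqintegrableP[mR mI fi] := repr_sqintegrable w.
  have iw := integrable_abs2_dominated (repr_sqintegrable w).
  have ffin := integrable_fin_num measurableT fi.
  rewrite sqnorm_repr -lee_fin EFinM /Rintegral.
  rewrite !fineK//; last exact: (integrable_fin_num mD iw).
  apply: dominated_integral; last by move=> x; rewrite lee_fin abs2_ge0.
  exact/measurable_EFinP/measurable_abs2.
rewrite mulrDr; apply: le_trans (lerD (bd u) (bd v)).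
apply: (le_trans (le_normr_Rintegral mD (integrable_pairing uP vP))).
rewrite -RintegralD//; apply: le_Rintegral => //.
- have := integrable_norm (integrable_pairing uP vP); exact: eq_integrable.
- exact: (integrableD mD iu iv).
- by move=> x _; exact: Re_mul_le.
Qed.

Lemma L2pairing_functional v : real_functional (L2pairing^~ v).
Proof.
split => [u u'|r u|]; [exact: L2pairingDl|exact: L2pairingZl|].
exists (C * (1 + sqnorm v)) => u; apply: (le_trans (L2pairing_bound u v)).
rewrite -mulrA ler_wpM2l//.
have := sqnorm_ge0 u; have := sqnorm_ge0 v; nra.
Qed.

Lemma L2pairing_functionalr u : real_functional (L2pairing u).
Proof.
have := L2pairing_functional u.
by rewrite (_ : L2pairing^~ u = L2pairing u)//; apply/funext => v; exact: L2pairingC.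
Qed.

(** Pairing with the complex conjugate integrates the squared modulus. *)
Lemma L2pairing_eq0 v : (forall u, L2pairing u v = 0) ->
  {ae nu, forall x, D x -> repr v x = 0}.
Proof.
have vP := repr_sqintegrable v; have /sqintegrableP[mR mI vi] := vP.
pose w : T -> R[i]^o := fun x => Complex (complex.Re (repr v x)) (- complex.Im (repr v x)).
have wP : w \in sqintegrable mu.
  apply: (sqintegrable_le _ _ vi) => //.
    exact: measurableT_comp.
  by move=> x; rewrite /abs2/= sqrrN.
move=> /(_ (toL2 mu w)); rewrite -{1}[v]reprL2K L2pairing_toL2//.
have E x : complex.Re (w x * repr v x) = abs2 (repr v x).
  by rewrite /w; case: (repr v x) => a b; rewrite /abs2/=; ring.
rewrite /pairing; under eq_Rintegral do rewrite E.
have iv := integrable_abs2_dominated vP.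
move=> i0; have [H _] := ae_eq_integral_abs nu mD (measurable_int _ iv).
have {}i0 : (\int[nu]_(x in D) `|(EFin \o (abs2 \o repr v)) x| = 0)%E.
  under eq_integral do rewrite gee0_abs ?lee_fin ?abs2_ge0//.
  by rewrite -[LHS]fineK ?(integrable_fin_num mD iv)//; congr EFin.
by apply: filterS (H i0) => x Hx Dx; have [/abs2_eq0] := Hx Dx.
Qed.

End pairing.
(** * Dyadic cubes *)

Section dyadic.
Context (R : realType) (n : nat).
Implicit Types (p q : euclid R n) (j : n.-tuple int).

(** Cubes are encoded as the fibres of this map: at each level they partition
   the space, and nesting becomes factorisation, see [dyadic_floor_le]. *)
Definition dyadic_floor (l : nat) p : n.-tuple int :=
  [tuple Num.floor (2 ^+ l * coord p i : R) | i < n].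

Definition cube (l : nat) j : set (euclid R n) := [set p | dyadic_floor l p = j].

Lemma cubeP l j p : cube l j p <->
  forall i, (tnth j i)%:~R <= 2 ^+ l * coord p i < (tnth j i + 1)%:~R.
Proof.
split => [<- i|H]; first by rewrite tnth_mktuple floor_itv.
by apply: eq_from_tnth => i; rewrite tnth_mktuple; exact: floor_def.
Qed.

Lemma measurable_forall_coord (A : 'I_n -> set (measurableTypeR R)) :
  (forall i, measurable (A i)) ->
  measurable [set p : euclid R n | forall i, A i (coord p i)].
Proof.
move=> mA; rewrite (_ : mkset _ = \bigcap_(i : 'I_n)
    (fun p : euclid R n => coord p i) @^-1` A i); last first.
  by apply/seteqP; split => p /= H i; [move=> _|]; exact: H.
apply: fin_bigcap_measurable => // i _; rewrite -[X in measurable X]setTI.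
by apply: measurable_coord => //; exact: mA.
Qed.

Lemma measurable_cube l j : measurable (cube l j).
Proof.
pose I z : set (measurableTypeR R) := `[(z%:~R / 2 ^+ l : R), (z + 1)%:~R / 2 ^+ l[%classic.
rewrite (_ : cube l j = [set p | forall i, I (tnth j i) (coord p i)]).
  by apply: (measurable_forall_coord (A := fun i => I (tnth j i))) => i;
    exact: measurable_itv.
apply/seteqP; split => p.
  move=> /cubeP H i; rewrite /I /= in_itv/=.
  by rewrite ler_pdivrMr ?exprn_gt0// ltr_pdivlMr ?exprn_gt0// mulrC.
move=> /= H; apply/cubeP => i; have := H i; rewrite /I /= in_itv/=.
by rewrite ler_pdivrMr ?exprn_gt0// ltr_pdivlMr ?exprn_gt0// mulrC.
Qed.

(** The floor of [2 ^ k x] is the largest integer [z] such that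
   [z 2 ^ (l - k)] is at most the floor of [2 ^ l x]. *)
Lemma dyadic_floor_le k l p q : (k <= l)%N ->
  dyadic_floor l p = dyadic_floor l q -> dyadic_floor k p = dyadic_floor k q.
Proof.
move=> kl pq; apply: eq_from_tnth => i; rewrite !tnth_mktuple.
have {pq} E : Num.floor (2 ^+ l * coord p i : R) = Num.floor (2 ^+ l * coord q i : R).
  by have := congr1 (fun t => tnth t i) pq; rewrite !tnth_mktuple.
have le2 (z : int) (x : R) : (z <= Num.floor (2 ^+ k * x : R)) =
    (z * 2 ^+ (l - k)%N <= Num.floor (2 ^+ l * x : R)).
  rewrite !floor_ge_int rmorphM rmorphXn/=.
  have -> : 2 ^+ l * x = 2 ^+ k * x * 2 ^+ (l - k) :> R.
    by rewrite -[in LHS](subnK kl) exprD; ring.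
  by rewrite ler_pM2r// exprn_gt0.
by apply/eqP; rewrite eq_le {1}le2 -E -le2 lexx le2 E -le2 lexx.
Qed.

Definition box (N : nat) : set (euclid R n) :=
  [set p | forall i, - N%:R <= coord p i < N%:R].

Lemma measurable_box N : measurable (box N).
Proof.
rewrite (_ : box N = [set p | forall i, (`[(- N%:R : R), N%:R[%classic) (coord p i)]).
  apply: (measurable_forall_coord (A := fun=> `[(- N%:R : R), N%:R[%classic)).
  by move=> i; exact: measurable_itv.
by apply/seteqP; split => p H i; have := H i; rewrite /= in_itv.
Qed.

(** A box with integral vertices is a union of cubes, of any level. *)
Lemma box_dyadic_floor N l p q : dyadic_floor l p = dyadic_floor l q ->
  box N p -> box N q.
Proof.
move=> /(dyadic_floor_le (leq0n l)) pq H i; have := H i.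
have := congr1 (fun t => tnth t i) pq; rewrite !tnth_mktuple !expr0 !mul1r => E.
have -> : - N%:R = (- N%:Z)%:~R :> R by rewrite rmorphN.
have -> : N%:R = (N%:Z)%:~R :> R by [].
by rewrite -!floor_ge_int !ltNge -!floor_ge_int E.
Qed.

Lemma lebesgue_box_lty N : (lebesgue_n (box N) < +oo)%E.
Proof.
rewrite (_ : box N = [set p | forall i, (`[(- N%:R : R), N%:R[%classic) (coord p i)]).
  rewrite (lebesgue_n_box (A := fun=> `[(- N%:R : R), N%:R[%classic)).
    rewrite -ge0_fin_numE; last by apply: prode_ge0 => i _; exact: measure_ge0.
    elim/big_ind: _ => //; first exact: fin_numM.
    move=> i _; rewrite lebesgue_measure_itv/=.
    by case: ifP => //.
  by move=> i; exact: measurable_itv.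
by apply/seteqP; split => p H i; have := H i; rewrite /= in_itv.
Qed.

Lemma box_le M N : (M <= N)%N -> box M `<=` box N.
Proof.
move=> MN p H i; have /andP[h1 h2] := H i.
have MN' : M%:R <= N%:R :> R by rewrite ler_nat.
by apply/andP; split; lra.
Qed.

Lemma coord_bound p : exists N : nat, forall i, `|coord p i| < N%:R.
Proof.
pose K := \sum_i `|coord p i|; exists (Num.truncn K).+1 => i.
apply: le_lt_trans (truncnS_gt K); rewrite /K (bigD1 i)//= lerDl.
exact: sumr_ge0.
Qed.

(** Unlike [box], exactly stable under reflection. *)
Definition sym_box (N : nat) : set (euclid R n) :=
  [set p | forall i, `|coord p i| < N%:R].

Lemma measurable_sym_box N : measurable (sym_box N).
Proof.
rewrite (_ : sym_box N = [set p | forall i, (`](- N%:R : R), N%:R[%classic) (coord p i)]).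
  apply: (measurable_forall_coord (A := fun=> `](- N%:R : R), N%:R[%classic)).
  by move=> i; exact: measurable_itv.
by apply/seteqP; split => p H i; have := H i; rewrite /= in_itv/= ltr_norml.
Qed.

Lemma sym_box_sub N : sym_box N `<=` box N.
Proof. by move=> p H i; have := H i; rewrite ltr_norml => /andP[/ltW -> ->]. Qed.

Lemma sym_box_le M N : (M <= N)%N -> sym_box M `<=` sym_box N.
Proof. by move=> MN p H i; apply: lt_le_trans (H i) _; rewrite ler_nat. Qed.

Lemma bigcup_sym_box : \bigcup_N sym_box N = setT.
Proof.
by apply/seteqP; split => // p _; have [N H] := coord_bound p; exists N.
Qed.

Lemma bigcup_box : \bigcup_N box N = setT.
Proof.
apply/seteqP; split => // p _; have [N H] := coord_bound p.
by exists N => //; exact: sym_box_sub.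
Qed.

Definition dyadic_system (l0 : nat) : set (set (euclid R n)) :=
  [set A | A = set0 \/ exists l j, (l0 <= l)%N /\ A = cube l j].

Lemma setI_cube k l j j' : (k <= l)%N ->
  cube k j `&` cube l j' = set0 \/ cube k j `&` cube l j' = cube l j'.
Proof.
move=> kl; have [->|/set0P[p [pj pj']]] := eqVneq (cube k j `&` cube l j') set0.
  by left.
right; apply/seteqP; split => [q []//|q qj']; split => //.
rewrite /cube /= -pj; apply: (dyadic_floor_le kl).
by rewrite qj'.
Qed.

Lemma setI_closed_dyadic l0 : setI_closed (dyadic_system l0).
Proof.
move=> A B [->|[k [j [lk ->]]]] [->|[l [j' [ll ->]]]]; rewrite ?set0I ?setI0;
  try by left.
have [kl|/ltnW lk'] := leqP k l.
  by have [->|->] := setI_cube j j' kl; [left|right; exists l, j'].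
by rewrite setIC; have [->|->] := setI_cube j' j lk'; [left|right; exists k, j].
Qed.

(** Each coordinate is the pointwise limit of its roundings to finer and finer
   grids. A rounding takes one value on each cube, and the cubes of a given
   level are countably many, hence it is measurable for the generated
   sigma-algebra. *)
Lemma dyadic_measurable l0 :
  @measurable _ (euclid R n) = <<s dyadic_system l0 >>.
Proof.
apply/seteqP; split; last first.
  apply: smallest_sub; first exact: sigma_algebra_measurable.
  by move=> A [->//|[l [j [_ ->]]]]; exact: measurable_cube.
pose T' := g_sigma_algebraType (dyadic_system l0).
have mc i : measurable_fun setT (fun p : T' => coord p i : measurableTypeR R).
  pose h k (p : T') : R := (Num.floor (2 ^+ (l0 + k) * coord p i : R))%:~R / 2 ^+ (l0 + k).
  apply: (@measurable_fun_cvg _ T' R setT h) => [k _ Y mY|p _].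
    rewrite setTI (_ : _ @^-1` _ = \bigcup_(j : n.-tuple int)
      (if `[< Y ((tnth j i)%:~R / 2 ^+ (l0 + k) : R) >] then cube (l0 + k) j else set0)).
      apply: countable_bigcupT_measurable; first exact: countableP.
      move=> j; case: asboolP => _; last exact: measurable0.
      apply: sub_sigma_algebra; right; exists (l0 + k)%N, j.
      by rewrite leq_addr.
    apply/seteqP; split => p /=.
      move=> Yp; exists (dyadic_floor (l0 + k) p) => //.
      by rewrite tnth_mktuple; case: asboolP.
    move=> [j _]; case: asboolP => // Yj /= pj.
    by move: Yj; rewrite -pj tnth_mktuple.
  (* rounding down to the grid of mesh 2 ^ - (l0 + k) *)
  apply/cvgrPdist_le => e e0.
  have [M Me] : exists M : nat, e^-1 < M%:R.
    by exists (Num.truncn e^-1).+1; exact: truncnS_gt.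
  exists M => //= k Mk; rewrite /h.
  set x := coord p i; set t : R := 2 ^+ (l0 + k).
  have t0 : 0 < t by rewrite exprn_gt0.
  have et : e^-1 <= t.
    apply: (le_trans (ltW Me)); apply: (@le_trans _ _ k%:R); first by rewrite ler_nat.
    rewrite /t -natrX ler_nat; apply: (leq_trans (ltnW (ltn_expl k (ltnSn 1)))).
    by rewrite leq_exp2l// leq_addl.
  have := floor_itv (t * x); set z : R := (Num.floor (t * x))%:~R => /andP[z1 z2].
  have -> : x - z / t = (t * x - z) / t by rewrite mulrBl mulrAC divff ?gt_eqF// mul1r.
  rewrite ger0_norm; last by rewrite divr_ge0 ?subr_ge0// ltW.
  rewrite ler_pdivrMr//; apply: (@le_trans _ _ 1).
    by move: z2; rewrite intrD -/z => /ltW; rewrite lerBlDl.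
  by rewrite -ler_pdivrMl// mulr1.
apply: smallest_sub => /=; first exact: (@sigma_algebra_measurable _ T').
move=> A H; have {H} : exists i : 'I_n, exists2 B : set (measurableTypeR R),
    measurable B & setT `&` (fun p : euclid R n => coord p i) @^-1` B = A.
  elim/big_ind: _ H => [//|X Y HX HY [/HX|/HY]//|i _ [B mB BA]].
  by exists i, B.
by move=> [i [B mB <-]]; exact: (mc i measurableT B mB).
Qed.

End dyadic.
(** * Density of the indicators of cubes *)

Section dyadic_density.
Context (R : realType) (n : nat) (mu : {measure set (euclid R n) -> \bar R}).
Hypothesis finbox : forall N, (mu (box N) < +oo)%E.
Implicit Types (L : L2 mu -> R) (c : R[i]).

(** Saturation makes [B] the disjoint union of the cubes of level [l] that it
   contains, enumerated through [pickle]. This applies to boxes, to coarser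
   cubes, and to their intersections. *)
Lemma functional_dyadic_union L c l (B : set (euclid R n)) :
  real_functional L -> (forall j, L (toL2 mu (cindic c (cube l j))) = 0) ->
  measurable B -> (mu B < +oo)%E ->
  (forall p q, dyadic_floor l p = dyadic_floor l q -> B p -> B q) ->
  L (toL2 mu (cindic c B)) = 0.
Proof.
move=> rL L0 mB finB satB.
pose F i : set (euclid R n) := if pickle_inv i is Some j
  then if `[< cube l j `<=` B >] then cube l j else set0 else set0.
have FE i p : F i p <-> i = pickle (dyadic_floor l p) /\ B p.
  rewrite /F; split.
    case E : (pickle_inv i) => [j|//]; case: asboolP => // jB pj.
    split; last exact: jB.
    by rewrite pj; have := @pickle_invK (n.-tuple int) i; rewrite E.
  move=> [-> Bp]; rewrite pickleK_inv; case: asboolP => // H; case: H => q qj.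
  by apply: satB Bp; rewrite qj.
have BF : B = \bigcup_i F i.
  apply/seteqP; split => [p Bp|p [i _ /FE[]//]].
  by exists (pickle (dyadic_floor l p)) => //; exact/FE.
rewrite BF; apply: functional_bigcup => //.
- move=> i; rewrite /F; case: pickle_inv => // j; case: ifP => // _.
  exact: measurable_cube.
- by apply/trivIsetP => i i' _ _ /eqP ii'; apply/seteqP; split => // p
    [/FE[ip _] /FE[ip' _]]; apply: ii'; rewrite ip.
- by rewrite -BF.
- move=> i; rewrite /F; case: pickle_inv => [j|]; last first.
    by rewrite cindic0 toL20 functional0.
  by case: ifP => // _; rewrite cindic0 toL20 functional0.
Qed.

(** Fine cubes alone generate the Borel sets; restricting to them allows a
   comparison with a fixed coarser cube, as in [convol_transpose_box]. *)
Lemma functional_dyadic_eq0 L (l0 : nat) : real_functional L ->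
  (forall c, c = 1 \/ c = 'i%C -> forall l j, (l0 <= l)%N ->
    L (toL2 mu (cindic c (cube l j))) = 0) ->
  forall u, L u = 0.
Proof.
move=> rL L0.
apply: (functional_eq0 (D := @box R n)) => //.
- exact: measurable_box.
- by move=> i j; exact: box_le.
- exact: bigcup_box.
move=> c c1i N A mA.
have L0' l j : (l0 <= l)%N -> L (toL2 mu (cindic c (cube l j))) = 0 by exact: L0.
have finI B : measurable B -> (mu (B `&` box N) < +oo)%E.
  move=> mB; apply: le_lt_trans (finbox N).
  by rewrite le_measure ?inE//; [apply: measurableI => //|]; exact: measurable_box.
apply: (functional_eq0_indic rL (dyadic_measurable R n l0)) => //.
- exact: setI_closed_dyadic.
- exact: measurable_box.
- apply: (functional_dyadic_union (l := l0)) => //.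
  + by move=> j; exact: L0'.
  + exact: measurable_box.
  + by move=> p q; exact: box_dyadic_floor.
- move=> B [->|[l [j [ll ->]]]]; first by rewrite set0I cindic0 toL20 functional0.
  apply: (functional_dyadic_union (l := l)) => //.
  + by move=> j'; exact: L0'.
  + by apply: measurableI; [exact: measurable_cube|exact: measurable_box].
  + by apply: finI; exact: measurable_cube.
  + by move=> p q pq [pj pN]; split; [rewrite /cube /= -pq|exact: (box_dyadic_floor pq)].
Qed.

Lemma cube_sub_box l (j : n.-tuple int) : exists N, cube (R := R) l j `<=` box N.
Proof.
have [->|/set0P[p pj]] := eqVneq (cube (R := R) l j) set0; first by exists 0%N.
have [N pN] := coord_bound p; exists N => q qj.
by apply: (box_dyadic_floor (l := l)) (sym_box_sub pN); exact: etrans pj (esym qj).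
Qed.

End dyadic_density.
(** * Invariance of Lebesgue measure under reflection *)

Section reflection.
Context (R : realType).

Definition vopp n (p : euclid R n) : euclid R n :=
  [tuple (- coord p i : measurableTypeR R) | i < n].

Lemma coord_vopp n (p : euclid R n) i : coord (vopp p) i = - coord p i.
Proof. by rewrite /coord tnth_mktuple. Qed.

Lemma coord_vsub n (p a : euclid R n) i : coord (vsub p a) i = coord p i - coord a i.
Proof. by rewrite {1}/coord tnth_mktuple. Qed.

Lemma euclid_eq n (p q : euclid R n) : (forall i, coord p i = coord q i) -> p = q.
Proof. by move=> pq; exact: eq_from_tnth. Qed.

Lemma voppK n : involutive (@vopp n).
Proof. by move=> p; apply: euclid_eq => i; rewrite !coord_vopp opprK. Qed.

Lemma measurable_vopp n : measurable_fun setT (@vopp n).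
Proof.
apply/measurable_fun_tnthP => i.
rewrite (_ : _ \o _ = fun p => - coord p i); last first.
  by apply/funext => p /=; rewrite tnth_mktuple.
by apply: measurableT_comp => //; exact: measurable_coord.
Qed.

Lemma lebesgue_measure_opp (A : set (measurableTypeR R)) : measurable A ->
  pushforward lebesgue_measure
    (fun x : measurableTypeR R => - x : measurableTypeR R) A =
  lebesgue_measure A.
Proof.
have mopp : measurable_fun setT (fun x : measurableTypeR R => - x : measurableTypeR R).
  exact: measurableT_comp.
pose nu : {measure set (measurableTypeR R) -> \bar R} :=
  pushforward lebesgue_measure (fun x : measurableTypeR R => - x : measurableTypeR R).
move=> mA; apply/esym; apply: (lebesgue_measure_unique (mu := nu mopp)) => //= _ [[x y]] _ <-.
rewrite /nu /= /pushforward /=.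
rewrite (_ : _ @^-1` _ = `[(- y)%R, (- x)%R[%classic); last first.
  by apply/seteqP; split => z /=; rewrite !in_itv/= lerNl ltrNr => /andP[-> ->].
rewrite !lebesgue_measure_itv /= !lte_fin ltrN2.
by case: ifPn => // _; rewrite -!EFinD opprK addrC.
Qed.

Lemma lebesgue_n_vopp n (A : set (euclid R n)) : measurable A ->
  lebesgue_n (@vopp n @^-1` A) = lebesgue_n A.
Proof.
elim: n A => [|n IHn] A mA /=.
  congr (\d_ _ _); apply/seteqP.
  by split => p; rewrite /preimage /= (tuple0 p) (tuple0 (vopp _)).
pose h (x : measurableTypeR R * euclid R n) : measurableTypeR R * euclid R n :=
  (- (x.1 : R), vopp x.2).
have mh : measurable_fun setT h.
  apply: measurable_fun_pair.
    by apply: measurableT_comp => //; exact: measurable_fst.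
  exact: (measurableT_comp (@measurable_vopp n) measurable_snd).
have mvA : measurable (@vcons R n @^-1` A).
  by rewrite -[X in measurable X]setTI; exact: measurable_vcons.
pose nu : {measure set _ -> \bar R} := pushforward (lebesgue_measure \x @lebesgue_n R n)%E h.
have Eh : @vcons R n @^-1` (@vopp n.+1 @^-1` A) = h @^-1` (@vcons R n @^-1` A).
  have vh y : vopp (vcons y) = vcons (h y).
    apply: euclid_eq => i; rewrite coord_vopp.
    case: y => x p; case: (unliftP ord0 i) => [j ->|->]; last by [].
    by rewrite coord_vconsS [RHS](coord_vconsS _ _ j) coord_vopp.
  by apply/seteqP; split => y /=; rewrite vh.
rewrite /pushforward Eh [RHS](product_measure_unique (m' := nu mh))//=.
move=> B C mB mC; rewrite /nu /pushforward /=.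
rewrite (_ : h @^-1` _ = ((fun x : measurableTypeR R => - (x : R) : measurableTypeR R) @^-1` B)
    `*` (@vopp n @^-1` C))//.
have mB' : measurable ((fun x : measurableTypeR R => - (x : R) : measurableTypeR R) @^-1` B).
  by rewrite -[X in measurable X]setTI; apply: measurableT_comp.
have mC' : measurable (@vopp n @^-1` C).
  by rewrite -[X in measurable X]setTI; exact: measurable_vopp.
rewrite product_measure1E//.
transitivity (pushforward lebesgue_measure
  (fun x : measurableTypeR R => (- x)%R : measurableTypeR R) B * lebesgue_n C)%E.
  by rewrite -(IHn C mC).
by rewrite lebesgue_measure_opp.
Qed.

End reflection.

Section invariant_integral.
Context (R : realType) (n : nat).

(** The positive and the negative parts are transported separately, so that the
   integral may be infinite or undefined. *)
Lemma lebesgue_integral_invariant (h : euclid R n -> euclid R n)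
    (f : euclid R n -> \bar R) (D : set (euclid R n)) :
  measurable_fun setT h ->
  (forall A, measurable A -> lebesgue_n (h @^-1` A) = lebesgue_n A) ->
  measurable D -> measurable_fun D f ->
  (\int[@lebesgue_n R n]_(p in h @^-1` D) f (h p) =
   \int[@lebesgue_n R n]_(p in D) f p)%E.
Proof.
move=> mh hinv mD mf.
pose nu : {measure set (euclid R n) -> \bar R} := pushforward (@lebesgue_n R n) h.
have H (g : euclid R n -> \bar R) : measurable_fun D g -> (forall x, 0 <= g x)%E ->
    (\int[@lebesgue_n R n]_(p in h @^-1` D) (g \o h) p =
     \int[@lebesgue_n R n]_(p in D) g p)%E.
  move=> mg g0; rewrite -ge0_integral_pushforward//.
  apply: (@eq_measure_integral _ _ _ _ (@lebesgue_n R n) (nu mh)).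
  by move=> A mA _; exact: hinv.
rewrite integralE [RHS]integralE; congr (_ - _)%E.
  by rewrite -H//; [under eq_integral do rewrite funepos_comp|exact: measurable_funepos].
by rewrite -H//; [under eq_integral do rewrite funeneg_comp|exact: measurable_funeneg].
Qed.

End invariant_integral.
(** * Operators and the convolution form on L^2(dp / E(p)) *)

Section shell.
Context (R : realType) (n : nat) (m : R) (m_gt0 : 0 < m).
Local Notation mu := (@shell_measure R n m).
Local Notation leb := (@lebesgue_n R n).
Implicit Types (f g : euclid R n -> R[i]^o) (u v w : L2 mu) (D : set (euclid R n)).

Lemma energy_vopp (p : euclid R n) : energy m (vopp p) = energy m p :> R.
Proof.
by congr (Num.sqrt (_ + _)); apply: eq_bigr => i _; rewrite coord_vopp sqrrN.
Qed.

Lemma shell_measure_vopp A : measurable A -> mu (@vopp R n @^-1` A) = mu A.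
Proof.
move=> mA; rewrite /= /shell_measure.
rewrite -[RHS](@lebesgue_integral_invariant _ _ (@vopp R n))//.
- by apply: eq_integral => p _; rewrite energy_vopp.
- exact: measurable_vopp.
- exact: lebesgue_n_vopp.
- apply: measurable_funTS; exact: measurable_inv_energy.
Qed.

Let vopp_le A : measurable A -> (mu (@vopp R n @^-1` A) <= 1%:E * mu A)%E.
Proof. by move=> mA; rewrite shell_measure_vopp// mul1e. Qed.

Lemma sqintegrable_vopp f : f \in sqintegrable mu ->
  (f \o @vopp R n : euclid R n -> R[i]^o) \in sqintegrable mu.
Proof.
move=> fP; exact: (sqintegrable_pullback (@measurable_vopp R n) vopp_le
  ler01 (MkL2fun fP)).
Qed.

Definition reflection u : L2 mu := toL2 mu ((repr u : _ -> R[i]^o) \o @vopp R n).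

Lemma reflection_toL2 f : f \in sqintegrable mu ->
  reflection (toL2 mu f) = toL2 mu (f \o @vopp R n : _ -> R[i]^o).
Proof.
move=> fP; apply: toL2_ae; rewrite ?sqintegrable_vopp ?repr_sqintegrable//.
apply: (ae_eq_pullback (@measurable_vopp R n) vopp_le); exact: repr_toL2.
Qed.

Lemma reflectionK u : reflection (reflection u) = u.
Proof.
rewrite -[u]reprL2K !reflection_toL2 ?sqintegrable_vopp ?repr_sqintegrable//.
congr toL2; apply/funext => p /=.
by rewrite voppK.
Qed.

Lemma bounded_reflection : bounded_operators reflection.
Proof.
split.
  move=> c u v; rewrite -[u]reprL2K -[v]reprL2K.
  have uP := repr_sqintegrable u; have vP := repr_sqintegrable v.
  rewrite -toL2Z// -toL2D ?rpredZ// !reflection_toL2 ?rpredD ?rpredZ//.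
  by rewrite -toL2Z ?sqintegrable_vopp// -toL2D ?rpredZ ?sqintegrable_vopp.
exists (1 `^ 2^-1) => u; rewrite -[u]reprL2K.
rewrite reflection_toL2 ?repr_sqintegrable//.
rewrite (toL2E (repr_sqintegrable u)) (toL2E (sqintegrable_vopp (repr_sqintegrable u))).
rewrite !L2norm_class -lee_fin EFinM !fineK ?enorm2_fin_num//.
apply: (@enorm2_pullback _ _ _ _ _ _ (@measurable_vopp R n) vopp_le ler01 (repr u)).
exact: measurable_normc_L2fun.
Qed.

Lemma translation_toL2 a f : f \in sqintegrable mu ->
  (fun p => f (vsub p a)) \in sqintegrable mu /\
  translation m_gt0 a (toL2 mu f) = toL2 mu (fun p => f (vsub p a)).
Proof.
move=> fP; have gP := sqintegrable_vsub m_gt0 a (MkL2fun fP).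
split => //; rewrite (toL2E fP) translation_class (toL2E gP).
by congr L2class; exact/val_inj.
Qed.

Lemma sqintegrable_trunc D f : measurable D -> f \in sqintegrable mu ->
  (fun p => (\1_D p)%:C%C * f p : R[i]^o) \in sqintegrable mu.
Proof.
move=> mD /sqintegrableP[mR mI fi]; apply: (sqintegrable_le _ _ fi).
- under eq_fun do rewrite mulrC Re_mulr_real.
  by apply: measurable_funM => //; exact: measurable_indic.
- under eq_fun do rewrite mulrC Im_mulr_real.
  by apply: measurable_funM => //; exact: measurable_indic.
- move=> p; rewrite abs2M abs2_real indicE.
  by case: (p \in D); rewrite /= ?expr1n ?expr0n/= ?mul1r// mul0r abs2_ge0.
Qed.

Definition trunc D u : L2 mu := toL2 mu (fun p => (\1_D p)%:C%C * repr u p).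

Lemma trunc_toL2 D f : measurable D -> f \in sqintegrable mu ->
  trunc D (toL2 mu f) = toL2 mu (fun p => (\1_D p)%:C%C * f p).
Proof.
move=> mD fP; apply: toL2_ae; rewrite ?sqintegrable_trunc ?repr_sqintegrable//.
by apply: filterS (repr_toL2 fP) => p fp _; rewrite fp.
Qed.

Lemma bounded_trunc D : measurable D -> bounded_operators (trunc D).
Proof.
move=> mD; split.
  move=> c u v; rewrite -[u]reprL2K -[v]reprL2K.
  have uP := repr_sqintegrable u; have vP := repr_sqintegrable v.
  rewrite -toL2Z// -toL2D ?rpredZ// !trunc_toL2 ?rpredD ?rpredZ//.
  rewrite -toL2Z ?sqintegrable_trunc// -toL2D ?rpredZ ?sqintegrable_trunc//.
  congr toL2; apply/funext => p.
  rewrite -[LHS]/(_ * (c * repr u p + repr v p)) -[RHS]/(c * (_ * _) + _ * _).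
  by rewrite mulrDr mulrCA.
exists 1 => u; rewrite mul1r -ler_sqr ?nnegrE ?fine_ge0 ?Lnorm_ge0//.
rewrite -!/(sqnorm _) /trunc.
have uP := repr_sqintegrable u; have tP := sqintegrable_trunc mD uP.
rewrite sqnorm_toL2// sqnorm_repr; apply: le_Rintegral => //.
- by have /sqintegrableP[] := tP.
- by have /sqintegrableP[] := uP.
- move=> p _; rewrite abs2M abs2_real indicE.
  by case: (p \in D); rewrite /= ?expr1n ?expr0n/= ?mul1r// mul0r abs2_ge0.
Qed.

Lemma trunc_trunc D D' u : measurable D -> measurable D' -> D `<=` D' ->
  trunc D' (trunc D u) = trunc D u.
Proof.
move=> mD mD' DD'; rewrite {2}/trunc trunc_toL2 ?sqintegrable_trunc ?repr_sqintegrable//.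
congr toL2; apply/funext => p; rewrite mulrA -rmorphM/= !indicE.
congr (_%:C%C * _); case: (boolP (p \in D)) => pD; last by rewrite mulr0.
by rewrite mem_set ?mulr1//; apply: DD'; exact: set_mem.
Qed.

Lemma energy_bound N (p : euclid R n) : box N p ->
  energy m p <= Num.sqrt (n%:R * N%:R ^+ 2 + m ^+ 2).
Proof.
move=> pN; rewrite ler_wsqrtr// lerD2r; apply: (@le_trans _ _ (\sum_(i < n) N%:R ^+ 2)).
  apply: ler_sum => i _; have /andP[h1 h2] := pN i.
  by rewrite -subr_ge0 subr_sqr mulr_ge0//; lra.
by rewrite sumr_const card_ord mulr_natl.
Qed.

Definition bounded_domain D := measurable D /\ exists N, D `<=` box N.

(** The energy is bounded on bounded sets. *)
Lemma lebesgue_dominated D : bounded_domain D -> exists C : R, 0 <= C /\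
  forall A, measurable A -> (leb (A `&` D) <= C%:E * mu A)%E.
Proof.
move=> [mD [N DN]]; pose C : R := Num.sqrt (n%:R * N%:R ^+ 2 + m ^+ 2).
have C0 : 0 <= C by exact: sqrtr_ge0.
exists C; split => // A mA; have mAD : measurable (A `&` D) by exact: measurableI.
have mI := measurable_inv_energy m (n := n).
have I0 (p : euclid R n) : (0 <= ((energy m p)^-1)%:E)%E.
  by rewrite lee_fin invr_ge0 sqrtr_ge0.
apply: (@le_trans _ _ (C%:E * mu (A `&` D))%E); last first.
  apply: lee_wpmul2l; first by rewrite lee_fin.
  by apply: le_measure; rewrite ?inE//; exact: subIsetl.
rewrite /= /shell_measure -ge0_integralZl//; last exact: measurable_funTS.
rewrite -[leLHS]mul1e -integral_cst//; apply: ge0_le_integral => //.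
- by apply: measurable_funTS; exact: measurable_funeM.
- move=> p [_ pD]; rewrite -EFinM lee_fin ler_pdivlMr ?energy_gt0// mul1r.
  exact: energy_bound (DN _ pD).
Qed.

Lemma shell_box_lty N : (mu (box N) < +oo)%E.
Proof.
have mI := measurable_inv_energy m (n := n).
rewrite /= /shell_measure; apply: (@le_lt_trans _ _ (\int[leb]_(p in box N) (m^-1)%:E)%E).
  apply: ge0_le_integral => //.
  - exact: measurable_box.
  - by move=> p _; rewrite lee_fin invr_ge0 sqrtr_ge0.
  - exact: measurable_funTS.
  - move=> p _; rewrite lee_fin lef_pV2 ?posrE ?energy_gt0//.
    rewrite -[leLHS]gtr0_norm// -sqrtr_sqr ler_wsqrtr// lerDr.
    by apply: sumr_ge0 => i _; exact: sqr_ge0.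
rewrite integral_cst; last exact: measurable_box.
by rewrite lte_mul_pinfty ?lee_fin ?invr_ge0 ?ltW// lebesgue_box_lty.
Qed.

(** Real part of [\int_D u (p) v (- p) dp], the value at the origin of the
   convolution of [u] cut off to [D] with [v]. Two square-integrable functions
   for [dp / E(p)] need not have a convolution, which is why [D] is bounded. *)
Definition convol D u v : R := L2pairing leb D u (reflection v).

Lemma convol_toL2 D f g : bounded_domain D -> f \in sqintegrable mu ->
  g \in sqintegrable mu ->
  convol D (toL2 mu f) (toL2 mu g) = \int[leb]_(p in D) complex.Re (f p * g (vopp p)).
Proof.
move=> bD fP gP; have [C [C0 dom]] := lebesgue_dominated bD; have [mD _] := bD.
by rewrite /convol reflection_toL2// (L2pairing_toL2 mD dom)// sqintegrable_vopp.
Qed.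

Lemma convol_functionall D v : bounded_domain D -> real_functional (fun u => convol D u v).
Proof.
move=> bD; have [C [C0 dom]] := lebesgue_dominated bD; have [mD _] := bD.
exact: (L2pairing_functional mD C0 dom).
Qed.

Lemma convol_functionalr D u : bounded_domain D -> real_functional (convol D u).
Proof.
move=> bD; have [C [C0 dom]] := lebesgue_dominated bD; have [mD _] := bD.
exact: (functional_comp (L2pairing_functionalr mD C0 dom u) bounded_reflection).
Qed.

Lemma convolC D u v : bounded_domain D -> @vopp R n @^-1` D = D ->
  convol D u v = convol D v u.
Proof.
move=> bD sD; have [mD _] := bD.
have uP := repr_sqintegrable u; have vP := repr_sqintegrable v.
rewrite -[u]reprL2K -[v]reprL2K !convol_toL2//; congr fine.
rewrite -[LHS](@lebesgue_integral_invariant _ _ (@vopp R n))//.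
- by rewrite sD; apply: eq_integral => p _; rewrite voppK mulrC.
- exact: measurable_vopp.
- exact: lebesgue_n_vopp.
- apply/measurable_EFinP/measurable_funTS.
  exact: (measurable_Re_mul uP (sqintegrable_vopp vP)).
Qed.

Lemma convol_trunc D B u v : bounded_domain B -> measurable D -> D `<=` B ->
  convol B (trunc D u) v = convol D u v.
Proof.
move=> bB mD DB; have [mB [N BN]] := bB.
have bD : bounded_domain D by split => //; exists N; exact: subset_trans BN.
have uP := repr_sqintegrable u; have vP := repr_sqintegrable v.
rewrite -[u]reprL2K -[v]reprL2K trunc_toL2// !convol_toL2 ?sqintegrable_trunc//.
rewrite [LHS]Rintegral_mkcond [RHS]Rintegral_mkcond; apply: eq_Rintegral => p _.
rewrite !patchE; case: (boolP (p \in D)) => pD.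
  rewrite mem_set; last by apply: DB; exact: set_mem.
  by rewrite indicE pD mul1r.
by case: ifP => // _; rewrite indicE (negbTE pD) mul0r mul0r.
Qed.

(** The pairings over all the boxes vanish only if the reflection of [w] is zero
   Lebesgue-almost everywhere, and the shell measure has a density. *)
Lemma convol_eq0 w : (forall N u, convol (box N) u w = 0) -> w = 0.
Proof.
move=> w0; have bN N : bounded_domain (@box R n N).
  by split; [exact: measurable_box|exists N].
have H N : {ae leb, forall p, box N p -> repr (reflection w) p = 0}.
  have [C [C0 dom]] := lebesgue_dominated (bN N); have [mD _] := bN N.
  exact: (L2pairing_eq0 mD C0 dom (w0 N)).
have [A [mA A0 wA]] := ae_foralln H.
have muA : mu A = 0%E.
  apply: null_set_integral => //.
  by apply: measurable_funTS; exact: measurable_inv_energy.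
rewrite -[w]reflectionK; suff -> : reflection w = 0 by exact: operator0 bounded_reflection.
rewrite -[reflection w]reprL2K -toL20; apply: toL2_ae; rewrite ?repr_sqintegrable ?rpred0//.
exists A; split => // p /= np; apply: wA => /= H'; apply: np => _.
have : (\bigcup_N box N) p by rewrite bigcup_box.
by move=> [N _]; exact: H'.
Qed.

End shell.
(** * The form on cubes of the same level *)

Section commutant_of_translations.
Context (R : realType) (n : nat) (m : R) (m_gt0 : 0 < m).
Local Notation mu := (@shell_measure R n m).
Local Notation leb := (@lebesgue_n R n).
Local Notation cube := (@cube R n).
Local Notation box := (@box R n).
Implicit Types (u v w : L2 mu) (c : R[i]) (j : n.-tuple int).

Definition cube_class c l j : L2 mu := toL2 mu (cindic c (cube l j)).

Lemma shell_cube_lty l j : (mu (cube l j) < +oo)%E.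
Proof.
have [N jN] := cube_sub_box R l j.
apply: le_lt_trans (shell_box_lty n m_gt0 N).
by apply: le_measure; rewrite ?inE//; [exact: measurable_cube|exact: measurable_box].
Qed.

Lemma sqintegrable_cube c l j : cindic c (cube l j) \in sqintegrable mu.
Proof. by apply: sqintegrable_cindic; [exact: measurable_cube|exact: shell_cube_lty]. Qed.

Lemma bounded_box N : bounded_domain (box N).
Proof. by split; [exact: measurable_box|exists N]. Qed.

Lemma trunc_cube_sub c l j N : cube l j `<=` box N ->
  trunc (box N) (cube_class c l j) = cube_class c l j.
Proof.
move=> jN; rewrite /cube_class trunc_toL2; [|exact: measurable_box|exact: sqintegrable_cube].
congr toL2; apply/funext => p; rewrite /cindic mulrCA -rmorphM/= !indicE.
congr (_ * _%:C%C); case: (boolP (p \in cube l j)) => pj; last by rewrite mulr0.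
by rewrite mem_set ?mul1r//; apply: jN; exact: set_mem.
Qed.

Lemma trunc_cube_notsub c l j N : ~ (cube l j `<=` box N) ->
  trunc (box N) (cube_class c l j) = 0.
Proof.
move=> jN; rewrite /cube_class trunc_toL2; [|exact: measurable_box|exact: sqintegrable_cube].
rewrite -[RHS]toL20; congr toL2; apply/funext => p.
rewrite /cindic mulrCA -rmorphM/= !indicE.
case: (boolP (p \in box N)) => pN; last by rewrite mul0r mulr0.
case: (boolP (p \in cube l j)) => pj; last by rewrite mulr0 mulr0.
exfalso; apply: jN => q qj; apply: (box_dyadic_floor (l := l)) (set_mem pN).
exact: etrans (set_mem pj) (esym qj).
Qed.

Definition corner l j : euclid R n :=
  [tuple ((tnth j i)%:~R / 2 ^+ l : measurableTypeR R) | i < n].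

Lemma coord_corner l j i : coord (corner l j) i = (tnth j i)%:~R / 2 ^+ l.
Proof. by rewrite /coord tnth_mktuple. Qed.

Lemma cube_vsub l j (p : euclid R n) :
  cube l [tuple 0 | i < n] (vsub p (corner l j)) <-> cube l j p.
Proof.
have E i : 2 ^+ l * coord (vsub p (corner l j)) i = 2 ^+ l * coord p i - (tnth j i)%:~R.
  by rewrite coord_vsub coord_corner mulrBr [X in _ - X]mulrC divfK// expf_neq0.
by split=> /cubeP H; apply/cubeP => i; have := H i; rewrite E tnth_mktuple;
  rewrite add0r subr_ge0 ltrBlDl intrD.
Qed.

Lemma cube_class_translation c l j : cube_class c l j =
  c *: translation m_gt0 (corner l j) (cube_class 1 l [tuple 0 | i < n]).
Proof.
have [P ->] := translation_toL2 m_gt0 (corner l j) (sqintegrable_cube 1 l [tuple 0 | i < n]).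
rewrite -toL2Z//; congr toL2; apply/funext => p.
rewrite -[RHS]/(c * _) /cindic mul1r; congr (_ * _%:C%C); rewrite !indicE.
by congr ((nat_of_bool _)%:R); apply/idP/idP => /set_mem/cube_vsub; exact: mem_set.
Qed.

Lemma Linfty_rP S : Linfty_r (n := n) m_gt0 S <->
  bounded_operators S /\ forall a u, S (translation m_gt0 a u) = translation m_gt0 a (S u).
Proof.
split=> -[BS H]; split => //.
  by move=> a u; have := H (translation m_gt0 a) (ex_intro2 _ _ a I erefl);
    move=> /(congr1 (fun F => F u)).
by move=> _ [a _ <-]; apply/funext => u; exact: H.
Qed.

Lemma Linfty_r_comp S U : Linfty_r (n := n) m_gt0 S -> Linfty_r m_gt0 U ->
  Linfty_r m_gt0 (S \o U).
Proof.
move=> /Linfty_rP[BS TS] /Linfty_rP[BU TU]; apply/Linfty_rP; split; last first.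
  by move=> a u /=; rewrite TU TS.
have [C1 H1] := BS.2; have [C2 H2] := BU.2; split.
  by move=> c u v /=; rewrite (operatorD _ _ BU) (operatorZ _ _ BU)
    (operatorD _ _ BS) (operatorZ _ _ BS).
exists (`|C1| * C2) => u /=.
have n0 (v : L2 mu) : 0 <= L2norm v by rewrite fine_ge0// Lnorm_ge0.
apply: (le_trans (H1 _)); rewrite -mulrA; apply: (@le_trans _ _ (`|C1| * L2norm (U u))).
  by rewrite ler_wpM2r// ler_norm.
by rewrite ler_wpM2l.
Qed.

(** All the cubes of a given level are translates of one of them, so the images
   of all of them are known from the image of that one. *)
Lemma convol_cube S c c' l j j' K : Linfty_r (n := n) m_gt0 S ->
  cube l j `<=` box K ->
  convol (box K) (cube_class c l j) (S (cube_class c' l j')) =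
  \int[leb]_(p in cube l [tuple 0 | i < n]) complex.Re (c * c' *
    repr (S (cube_class 1 l [tuple 0 | i < n]))
      (vsub (vsub (vopp p) (corner l j)) (corner l j'))).
Proof.
move=> /Linfty_rP[BS TS] jK; set s := S (cube_class 1 _ _).
have sP := repr_sqintegrable s.
have [tP tE] := translation_toL2 m_gt0 (corner l j') sP.
rewrite (cube_class_translation c') (operatorZ _ _ BS) TS -/s -{1}[s]reprL2K tE.
rewrite -toL2Z// /cube_class convol_toL2//; last 3 first.
- exact: bounded_box.
- exact: sqintegrable_cube.
- exact: rpredZ.
pose F (p : euclid R n) := complex.Re (c * c' *
  repr s (vsub (vsub (vopp p) (corner l j)) (corner l j'))).
transitivity (\int[leb]_(p in cube l j) F (vsub p (corner l j))).
  rewrite Rintegral_mkcond [RHS]Rintegral_mkcond; apply: eq_Rintegral => p _.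
  rewrite !patchE /F /cindic indicE.
  case: (boolP (p \in cube l j)) => pj; last by rewrite mulr0 mul0r if_same.
  rewrite mem_set; last by apply: jK; exact: set_mem.
  rewrite mulr1 -[X in _ * X]/(c' * _) mulrA; congr (complex.Re (_ * repr s (vsub _ _))).
  by apply: euclid_eq => i; rewrite !(coord_vsub, coord_vopp); ring.
congr fine; rewrite -[RHS](@lebesgue_integral_invariant _ _ (fun p => vsub p (corner l j)))//.
- rewrite (_ : _ @^-1` _ = cube l j)//.
  by apply/seteqP; split => p /cube_vsub.
- exact: measurable_vsub.
- exact: lebesgue_n_vsub.
- exact: measurable_cube.
have /sqintegrableP[mR mI _] := sP.
have mw : measurable_fun setT (fun p : euclid R n =>
    vsub (vsub (vopp p) (corner l j)) (corner l j')).
  apply: (measurableT_comp (measurable_vsub _)).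
  by apply: (measurableT_comp (measurable_vsub _)); exact: measurable_vopp.
apply/measurable_EFinP/measurable_funTS.
pose w p : euclid R n := vsub (vsub (vopp p) (corner l j)) (corner l j').
rewrite (_ : (fun p => _) = fun p => complex.Re (c * c') * complex.Re (repr s (w p))
  - complex.Im (c * c') * complex.Im (repr s (w p))).
  apply: measurable_funB; apply: measurable_funM => //.
    exact: (measurableT_comp mR mw).
  exact: (measurableT_comp mI mw).
by apply/funext => p; rewrite -/(w p); case: (c * c') => a b; case: (repr s _).
Qed.

(** Writing the cubes as the translates by [x]
   and [y] of the cube [e] at the origin, both sides are the real part of
   the integral of [c c' e (p) (S e) (- p - x - y)]. *)
Lemma convol_cubeC S c c' l j j' K K' : Linfty_r (n := n) m_gt0 S ->
  cube l j `<=` box K -> cube l j' `<=` box K' ->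
  convol (box K) (cube_class c l j) (S (cube_class c' l j')) =
  convol (box K') (cube_class c' l j') (S (cube_class c l j)).
Proof.
move=> LS jK jK'; rewrite !convol_cube//; apply: eq_Rintegral => p _.
rewrite [c' * c]mulrC; suff -> : vsub (vsub (vopp p) (corner l j')) (corner l j) =
  vsub (vsub (vopp p) (corner l j)) (corner l j') by [].
by apply: euclid_eq => i; rewrite !coord_vsub; ring.
Qed.

End commutant_of_translations.
(** * Commutativity of the commutant *)

Section commutativity.
Context (R : realType) (n : nat) (m : R) (m_gt0 : 0 < m).
Local Notation mu := (@shell_measure R n m).
Local Notation leb := (@lebesgue_n R n).
Local Notation cube := (@cube R n).
Local Notation box := (@box R n).
Local Notation sym_box := (@sym_box R n).
Local Notation cube_class := (@cube_class R n m).
Local Notation Linf := (Linfty_r (n := n) m_gt0).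
Implicit Types (u v w h : L2 mu) (c : R[i]) (j : n.-tuple int).

Lemma convol_cube0 c l j N v : ~ (cube l j `<=` box N) ->
  convol (box N) (cube_class c l j) v = 0.
Proof.
move=> jN; have bN := bounded_box R n N.
rewrite -(convol_trunc m_gt0 _ _ bN (@measurable_box R n N) (@subset_refl _ _)).
by rewrite (trunc_cube_notsub m_gt0)// (functional0 (convol_functionall m_gt0 _ bN)).
Qed.

Lemma bounded_Linf S : Linf S -> bounded_operators S.
Proof. by move=> /Linfty_rP[]. Qed.

(** By density it is enough to take for [h] a cube of level at least [l]. *)
Lemma convol_transpose_box S c l j K N h : Linf S -> cube l j `<=` box K ->
  convol (box K) (cube_class c l j) (S (trunc (box N) h)) =
  convol (box N) h (S (cube_class c l j)).
Proof.
move=> LS jK; have BS := bounded_Linf LS.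
have bK := bounded_box R n K; have bN := bounded_box R n N.
have bT := @bounded_trunc R n m _ (@measurable_box R n N).
pose Lh h := convol (box K) (cube_class c l j) (S (trunc (box N) h)) -
  convol (box N) h (S (cube_class c l j)).
have rLh : real_functional Lh.
  apply: functional_sub; last exact: convol_functionall.
  apply: (functional_comp (L := fun v => convol (box K) (cube_class c l j) (S v))) => //.
  exact: (functional_comp (convol_functionalr m_gt0 _ bK)).
suff Lh0 : Lh h = 0 by apply/eqP; rewrite -subr_eq0; apply/eqP.
apply: (functional_dyadic_eq0 (shell_box_lty n m_gt0) (l0 := l) rLh).
move=> c' _ l' j' ll'; rewrite -/(cube_class c' l' j') /Lh.
have [jN|jN] := pselect (cube l' j' `<=` box N); last first.
  rewrite (trunc_cube_notsub m_gt0)// (operator0 BS) (convol_cube0 _ _ jN).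
  by rewrite (functional0 (convol_functionalr m_gt0 _ bK)) subrr.
rewrite (trunc_cube_sub m_gt0)//.
(* [convol_cubeC] compares cubes of equal levels: the coarser one, of level
   [l], is split into cubes of level [l'] *)
pose Lf f := convol (box K) f (S (cube_class c' l' j')) -
  convol (box N) (cube_class c' l' j') (S (trunc (box K) f)).
have rLf : real_functional Lf.
  apply: functional_sub; first exact: convol_functionall.
  have rN := functional_comp (convol_functionalr m_gt0 (cube_class c' l' j') bN) BS.
  exact: (functional_comp rN (@bounded_trunc R n m _ (@measurable_box R n K))).
have := functional_dyadic_union (c := c) (l := l') (B := cube l j) rLf.
rewrite -/(cube_class c l j) /Lf (trunc_cube_sub m_gt0 c jK); apply.
- move=> j''; rewrite -/(cube_class c l' j'').
  have [jK'|jK'] := pselect (cube l' j'' `<=` box K).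
    by rewrite (trunc_cube_sub m_gt0)// (convol_cubeC c c' LS jK' jN) subrr.
  rewrite (trunc_cube_notsub m_gt0)// (operator0 BS) (convol_cube0 _ _ jK').
  by rewrite (functional0 (convol_functionalr m_gt0 _ bN)) subrr.
- exact: measurable_cube.
- exact: (shell_cube_lty m_gt0).
- by move=> p q pq; exact: etrans (esym (dyadic_floor_le ll' pq)).
Qed.

Lemma convol_transpose S c l j K (D : set (euclid R n)) h : Linf S ->
  cube l j `<=` box K -> bounded_domain D ->
  convol (box K) (cube_class c l j) (S (trunc D h)) =
  convol D h (S (cube_class c l j)).
Proof.
move=> LS jK [mD [N DN]].
rewrite -(trunc_trunc _ mD (@measurable_box R n N) DN).
by rewrite convol_transpose_box// (convol_trunc m_gt0)//; exact: bounded_box.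
Qed.

Lemma convol_transpose_cube S c c' l l' j j' K K' : Linf S ->
  cube l j `<=` box K -> cube l' j' `<=` box K' ->
  convol (box K) (cube_class c l j) (S (cube_class c' l' j')) =
  convol (box K') (cube_class c' l' j') (S (cube_class c l j)).
Proof.
move=> LS jK jK'; have := convol_transpose_box c K' (cube_class c' l' j') LS jK.
by rewrite (trunc_cube_sub m_gt0 c' jK').
Qed.

Lemma sym_box_vopp N : @vopp R n @^-1` sym_box N = sym_box N.
Proof. by apply/seteqP; split => p H i; have := H i; rewrite coord_vopp normrN. Qed.

Lemma bounded_sym_box N : bounded_domain (sym_box N).
Proof. by split; [exact: measurable_sym_box|exists N; exact: sym_box_sub]. Qed.

(** In the limit, the truncation inside [S] in [convol_transpose] disappears. The
   one in the form of [h] with [S f] remains: neither has bounded support. *)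
Lemma convol_trunc_cvg S c l j K h : Linf S -> cube l j `<=` box K ->
  convol (sym_box N) h (S (cube_class c l j)) @[N --> \oo] -->
  convol (box K) (cube_class c l j) (S h).
Proof.
move=> LS jK; have BS := bounded_Linf LS.
have hP := repr_sqintegrable h; have /sqintegrableP[_ _ hi] := hP.
under eq_fun do rewrite -(convol_transpose _ _ LS jK (bounded_sym_box _)).
have bK := bounded_box R n K.
have rL := functional_comp (convol_functionalr m_gt0 (cube_class c l j) bK) BS.
have := @functional_cvg _ _ _ _ _
  (fun N p => (\1_(sym_box N) p)%:C%C * repr h p) (repr h) (abs2 \o repr h) rL.
rewrite reprL2K; apply.
- by move=> N; apply: sqintegrable_trunc; [exact: measurable_sym_box|exact: hP].
- exact: hP.
- exact: hi.
- move=> N p; rewrite -[X in X - _]mul1r -mulrBl -(rmorph1 (real_complex R)) -rmorphB/=.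
  rewrite abs2M abs2_real indicE; case: (_ \in _).
    by rewrite subrr expr0n mul0r abs2_ge0.
  by rewrite subr0 expr1n mul1r.
- move=> p; apply: cvg_near_cst.
  have := indic_exhaustion R (@sym_box_le R n) (@bigcup_sym_box R n) p.
  apply: filterS => N E; rewrite [X in X%:C%C]E.
  by rewrite mul1r subrr /abs2/= expr0n addr0.
Qed.

(** For cubes [f] and [g], the forms of [f] with [S (U g)] and of [g] with
   [U (S f)] are limits of the pairings of [U g] with [S f] and of [S f] with
   [U g] over the same symmetric boxes, so they are equal. The latter is the
   form of [f] with [U (S g)], since [U \o S] is in the commutant. *)
Lemma convol_comm S U c c' l l' j j' K : Linf S -> Linf U -> cube l j `<=` box K ->
  convol (box K) (cube_class c l j) (S (U (cube_class c' l' j'))) =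
  convol (box K) (cube_class c l j) (U (S (cube_class c' l' j'))).
Proof.
move=> LS LU jK; have [K' jK'] := cube_sub_box R l' j'.
rewrite -[U (S _)]/((U \o S) _).
rewrite (convol_transpose_cube _ _ (Linfty_r_comp LU LS) jK jK').
have c1 := convol_trunc_cvg (c := c) (h := U (cube_class c' l' j')) LS jK.
have c2 := convol_trunc_cvg (c := c') (h := S (cube_class c l j)) LU jK'.
have E : (fun N => convol (sym_box N) (U (cube_class c' l' j')) (S (cube_class c l j))) =
    (fun N => convol (sym_box N) (S (cube_class c l j)) (U (cube_class c' l' j'))).
  apply/funext => N; apply: (convolC m_gt0); first exact: bounded_sym_box.
  exact: sym_box_vopp.
by rewrite E in c1; exact: (cvg_unique (@Rhausdorff R) c1 c2).
Qed.

Lemma Linfty_r_abelian S U : Linf S -> Linf U -> S \o U = U \o S.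
Proof.
move=> LS LU; have BS := bounded_Linf LS; have BU := bounded_Linf LU.
have bb := bounded_box R n.
pose W u := S (U u) - U (S u).
have W0 N u c l j : convol (box N) u (W (cube_class c l j)) = 0.
  have rL := convol_functionall m_gt0 (W (cube_class c l j)) (bb N).
  apply: (functional_dyadic_eq0 (shell_box_lty n m_gt0) (l0 := 0) rL) => c' _ l' j' _.
  rewrite -/(cube_class c' l' j').
  have [jN|jN] := pselect (cube l' j' `<=` box N); last exact: convol_cube0.
  rewrite (functionalB _ _ (convol_functionalr m_gt0 _ (bb N))).
  by rewrite (convol_comm _ _ _ _ LS LU jN) subrr.
apply/funext => h; apply/eqP; rewrite -subr_eq0; apply/eqP => /=.
apply: (convol_eq0 m_gt0) => N u; rewrite -/(W h).
have rL := convol_functionalr m_gt0 u (bb N).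
have rLW : real_functional (fun h => convol (box N) u (W h)).
  have -> : (fun h => convol (box N) u (W h)) = (fun h =>
      convol (box N) u (S (U h)) - convol (box N) u (U (S h))).
    by apply/funext => v; rewrite (functionalB _ _ rL).
  apply: functional_sub.
    exact: (functional_comp (functional_comp rL BS) BU).
  exact: (functional_comp (functional_comp rL BU) BS).
apply: (functional_dyadic_eq0 (shell_box_lty n m_gt0) (l0 := 0) rLW) => c _ l j _.
exact: W0.
Qed.

Lemma translation_comm a b u :
  translation m_gt0 a (translation m_gt0 b u) = translation m_gt0 b (translation m_gt0 a u).
Proof.
have uP := repr_sqintegrable u; rewrite -[u]reprL2K.
have [Pa Ea] := translation_toL2 m_gt0 a uP; have [Pb Eb] := translation_toL2 m_gt0 b uP.
rewrite Ea Eb; have [_ ->] := translation_toL2 m_gt0 a Pb.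
have [_ ->] := translation_toL2 m_gt0 b Pa; congr toL2; apply/funext => p.
by congr (repr u _); apply: euclid_eq => i; rewrite !coord_vsub; ring.
Qed.

Lemma Linfty_r_translation a : Linf (translation m_gt0 a).
Proof.
apply/Linfty_rP; split; first exact: bounded_translation.
by move=> b u; exact: translation_comm.
Qed.

Lemma Linfty_r_subalgebra : subalgebra Linf.
Proof.
have BT a := bounded_translation m_gt0 (n := n) a.
have n0 (v : L2 mu) : 0 <= L2norm v by rewrite fine_ge0// Lnorm_ge0.
split.
- by move=> S /bounded_Linf.
- apply/Linfty_rP; split; last by move=> a u; rewrite (operator0 (BT a)).
  split; first by move=> c u v; rewrite scaler0 addr0.
  exists 0 => u; rewrite mul0r.
  have := sqnorm0 mu; rewrite /sqnorm => /eqP.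
  by rewrite sqrf_eq0 => /eqP ->.
- move=> c S U /Linfty_rP[BS TS] /Linfty_rP[BU TU]; apply/Linfty_rP; split.
    split.
      move=> a u v.
      rewrite -[LHS]/(c *: S (a *: u + v) + U (a *: u + v)).
      rewrite -[RHS]/(a *: (c *: S u + U u) + (c *: S v + U v)).
      rewrite (operatorD _ _ BS) (operatorZ _ _ BS) (operatorD _ _ BU) (operatorZ _ _ BU).
      by rewrite !scalerDr !scalerA [c * a]mulrC addrACA.
    have [C1 [C10 H1]] := sqnorm_bounded BS; have [C2 [C20 H2]] := sqnorm_bounded BU.
    apply: (bounded_sqnorm (C := 2 * (abs2 c * C1 + C2))) => u.
    rewrite -[X in sqnorm X]/(c *: S u + U u); apply: (le_trans (sqnormD _ _)).
    rewrite sqnormZ -mulrA; apply: ler_wpM2l => //.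
    have -> : (abs2 c * C1 + C2) * sqnorm u = abs2 c * (C1 * sqnorm u) + C2 * sqnorm u.
      by ring.
    by apply: lerD => //; apply: ler_wpM2l; rewrite ?abs2_ge0.
  move=> a u.
  rewrite -[LHS]/(c *: S (translation m_gt0 a u) + U (translation m_gt0 a u)).
  rewrite -[in RHS]/(c *: S u + U u).
  by rewrite (operatorD _ _ (BT a)) (operatorZ _ _ (BT a)) TS TU.
- by move=> S U; exact: Linfty_r_comp.
Qed.

End commutativity.
Theorem corollary18 (R : realType) (n : nat) (n_ge1 : (1 <= n)%N)
    (m : R) (m_gt0 : 0 < m) :
  maximal_abelian_subalgebra (Linfty_r (n := n) m_gt0).
Proof.
split; [exact: Linfty_r_subalgebra|exact: Linfty_r_abelian|].
move=> B [BB _ _ _] abB LB; apply/seteqP; split => // S BS.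
apply/Linfty_rP; split; first exact: BB.
move=> a u; have TB := LB _ (Linfty_r_translation m_gt0 a).
exact: (congr1 (fun F => F u) (abB _ _ BS TB)).
Qed.
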